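(* Let $G$ and $H$ be two groups that split as graph products over the same finite simple graph $\Gamma$, with countable vertex groups $\{G_v\}_{v\in V\Gamma}$ and $\{H_v\}_{v\in V\Gamma}$, respectively. Assume that for every vertex $v\in V\Gamma$, the groups $G_v$ and $H_v$ admit orbit equivalent free measure-preserving actions on standard probability spaces. Then $G$ and $H$ admit orbit equivalent free measure-preserving actions on standard probability spaces; in particular $G$ and $H$ are measure equivalent.
   Context: Given a finite simple graph $\Gamma$ with vertex set $V\Gamma$ and a group $G_v$ for every $v\in V\Gamma$, the graph product over $\Gamma$ with vertex groups $\{G_v\}_{v\in V\Gamma}$ is the quotient of the free product of the groups $G_v$ by the relations $[g,h]=1$ for all $g\in G_v$, $h\in G_w$ whenever $v$ and $w$ are adjacent in $\Gamma$. Two measure-preserving actions $G\curvearrowright X$ and $H\curvearrowright Y$ of countable groups on standard probability spaces are orbit equivalent if there is a measure space isomorphism $f:X\to Y$ (between conull Borel subsets) such that $f(G\cdot x)=H\cdot f(x)$ for a.e. $x\in X$. Actions are free in the measure-theoretic sense (a.e. point has trivial stabilizer). Two countable groups $G$ and $H$ are measure equivalent if there exists a standard measure space $\Sigma$ (with a nonzero $\sigma$-finite measure) equipped with a measure-preserving action of $G\times H$ by Borel automorphisms such that the action of each of the two factors on $\Sigma$ is essentially free and has a fundamental domain of finite measure. *)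

(* Defs.v *)
(* MathComp / MathComp-Analysis *)
From HB Require Import structures.
From mathcomp Require Import all_boot all_order all_algebra generic_quotient.
From mathcomp Require Import all_classical all_reals all_analysis.

Set Implicit Arguments.
Unset Strict Implicit.
Unset Printing Implicit Defensive.

Import Order.TTheory GRing.Theory Num.Theory.

Local Open Scope classical_set_scope.
Local Open Scope quotient_scope.
Local Open Scope ring_scope.
Local Open Scope group_scope.

Section FreeProduct.
Variables (I : choiceType) (G : I -> groupType).

Let word := seq {i : I & G i}.
Let letter (i : I) (g : G i) : {i : I & G i} := Tagged G g.

(** The congruence on words whose classes are the elements of the free
    product: erase a trivial letter, or multiply two consecutive letters lying
    in the same factor. *)
Inductive free_cong : word -> word -> Prop :=
| free_cong_refl s : free_cong s s
| free_cong_sym s t : free_cong s t -> free_cong t s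
| free_cong_trans s t u : free_cong s t -> free_cong t u -> free_cong s u
| free_cong_one s t i :
    free_cong (s ++ letter (1 : G i) :: t) (s ++ t)
| free_cong_mul s t i (g h : G i) :
    free_cong (s ++ letter g :: letter h :: t) (s ++ letter (g * h) :: t).

Definition free_rel (s t : word) : bool := `[< free_cong s t >].

Lemma free_rel_refl : reflexive free_rel.
Proof. by move=> s; apply/asboolP; exact: free_cong_refl. Qed.

Lemma free_rel_sym : symmetric free_rel.
Proof. by move=> s t; apply/asboolP/asboolP; exact: free_cong_sym. Qed.

Lemma free_rel_trans : transitive free_rel.
Proof.
move=> t s u /asboolP st /asboolP tu; apply/asboolP.
exact: free_cong_trans st tu.
Qed.

Canonical free_equiv :=
  EquivRel free_rel free_rel_refl free_rel_sym free_rel_trans.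

Definition free_product := {eq_quot free_equiv}.
HB.instance Definition _ := Choice.on free_product.
HB.instance Definition _ := EqQuotient.on free_product.

Lemma free_cong_cat s s' t t' :
  free_cong s s' -> free_cong t t' -> free_cong (s ++ t) (s' ++ t').
Proof.
move=> ss' tt'; apply: (@free_cong_trans _ (s' ++ t)).
  elim: ss' => {s s'} [s|s u _ /free_cong_sym//|s u v _ su _ uv|s u i|s u i g h].
  - exact: free_cong_refl.
  - exact: free_cong_trans su uv.
  - by rewrite -!catA; exact: free_cong_one.
  - by rewrite -!catA; exact: free_cong_mul.
elim: tt' => {t t'} [t|t u _ /free_cong_sym//|t u v _ tu _ uv|t u i|t u i g h].
- exact: free_cong_refl.
- exact: free_cong_trans tu uv.
- by rewrite !catA; exact: free_cong_one.
- by rewrite !catA; exact: free_cong_mul.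
Qed.

Let letterV (x : {i : I & G i}) := letter (tagged x)^-1.

Definition wordV (s : word) : word := rev (map letterV s).

Lemma free_congV s t : free_cong s t -> free_cong (wordV s) (wordV t).
Proof.
elim=> {s t} [s|s u _ /free_cong_sym//|s u v _ su _ uv|s u i|s u i g h].
- exact: free_cong_refl.
- exact: free_cong_trans su uv.
- rewrite /wordV !map_cat /= !rev_cat rev_cons cat_rcons /letterV /= invg1.
  exact: free_cong_one.
- rewrite /wordV !map_cat /= !rev_cat !rev_cons !cat_rcons /letterV /= invgM.
  exact: free_cong_mul.
Qed.

Lemma wordVK : involutive wordV.
Proof.
move=> s; rewrite /wordV map_rev revK -map_comp map_id_in// => -[i g] _ /=.
by rewrite /letterV/= invgK.
Qed.

Lemma free_congVl s : free_cong (wordV s ++ s) [::].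
Proof.
elim: s => [|[i g] s IH]; first exact: free_cong_refl.
rewrite /wordV /= rev_cons cat_rcons -/(wordV s).
apply: free_cong_trans IH.
apply: free_cong_trans (free_cong_mul _ _ _ _) _ => /=.
rewrite mulVg; exact: free_cong_one.
Qed.

Definition free_one : free_product := \pi_free_product [::].
Definition free_mul (x y : free_product) : free_product :=
  \pi_free_product (repr x ++ repr y).
Definition free_inv (x : free_product) : free_product :=
  \pi_free_product (wordV (repr x)).

Lemma free_piP s t :
  \pi_free_product s = \pi_free_product t <-> free_cong s t.
Proof. by split=> [/eqmodP/asboolP|st]//; apply/eqmodP/asboolP. Qed.

Lemma free_repr_pi s : free_cong (repr (\pi_free_product s)) s.
Proof. by apply/free_piP; rewrite reprK. Qed.

Lemma free_mul_pi s t :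
  free_mul (\pi_free_product s) (\pi_free_product t) =
  \pi_free_product (s ++ t).
Proof. by apply/free_piP/free_cong_cat; exact: free_repr_pi. Qed.

Lemma free_inv_pi s :
  free_inv (\pi_free_product s) = \pi_free_product (wordV s).
Proof. by apply/free_piP/free_congV; exact: free_repr_pi. Qed.

Lemma free_mulA : associative free_mul.
Proof.
elim/quotW=> s; elim/quotW=> t; elim/quotW=> u.
by rewrite (free_mul_pi t u) (free_mul_pi s t) !free_mul_pi catA.
Qed.

Lemma free_mul1 : left_id free_one free_mul.
Proof. by elim/quotW=> s; rewrite free_mul_pi. Qed.

Lemma free_mulr1 : right_id free_one free_mul.
Proof. by elim/quotW=> s; rewrite free_mul_pi cats0. Qed.

Lemma free_mulV : left_inverse free_one free_inv free_mul.
Proof.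
by elim/quotW=> s; rewrite free_inv_pi free_mul_pi; apply/free_piP/free_congVl.
Qed.

Lemma free_mulrV : right_inverse free_one free_inv free_mul.
Proof.
elim/quotW=> s; rewrite free_inv_pi free_mul_pi; apply/free_piP.
by rewrite -{1}[s]wordVK; exact: free_congVl.
Qed.

HB.instance Definition _ := isGroup.Build free_product
  free_mulA free_mul1 free_mulr1 free_mulV free_mulrV.

Definition free_in (i : I) (g : G i) : free_product :=
  \pi_free_product [:: letter g].

End FreeProduct.

Definition normal_subgroup (K : groupType) (N : set K) : Prop :=
  [/\ N 1,
      forall x y, N x -> N y -> N (x * y),
      forall x, N x -> N x^-1 &
      forall x y, N x -> N (x ^ y)].

Definition normal_closure (K : groupType) (R : set K) : set K :=
  smallest (@normal_subgroup K) R.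

Section QuotientGroup.
Variables (K : groupType) (R : set K).

Let N := normal_closure R.

Lemma normal_closureP : normal_subgroup N.
Proof.
split=> [M [[]]//|x y Nx Ny M RM|x Nx M RM|x y Nx M RM].
- by have [[_ MM _ _] _] := RM; apply: MM; [exact: Nx|exact: Ny].
- by have [[_ _ MV _] _] := RM; apply: MV; exact: Nx.
- by have [[_ _ _ MJ] _] := RM; apply: MJ; exact: Nx.
Qed.

Definition quotient_rel (x y : K) : bool := `[< N (x^-1 * y) >].

Lemma quotient_rel_refl : reflexive quotient_rel.
Proof.
by move=> x; apply/asboolP; rewrite mulVg; have [] := normal_closureP.
Qed.

Lemma quotient_rel_sym : symmetric quotient_rel.
Proof.
have [_ _ NV _] := normal_closureP.
by move=> x y; apply/asboolP/asboolP => /NV; rewrite invgM invgK.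
Qed.

Lemma quotient_rel_trans : transitive quotient_rel.
Proof.
have [_ NM _ _] := normal_closureP.
move=> y x z /asboolP xy /asboolP yz; apply/asboolP.
by have := NM _ _ xy yz; rewrite -mulgA mulVKg.
Qed.

Canonical quotient_equiv :=
  EquivRel quotient_rel quotient_rel_refl quotient_rel_sym quotient_rel_trans.

Definition quotient_group := {eq_quot quotient_equiv}.
HB.instance Definition _ := Choice.on quotient_group.
HB.instance Definition _ := EqQuotient.on quotient_group.

Definition quotient_one : quotient_group := \pi_quotient_group 1.
Definition quotient_mul (x y : quotient_group) : quotient_group :=
  \pi_quotient_group (repr x * repr y).
Definition quotient_inv (x : quotient_group) : quotient_group :=
  \pi_quotient_group (repr x)^-1.

Lemma quotient_piP x y :
  \pi_quotient_group x = \pi_quotient_group y <-> N (x^-1 * y).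
Proof. by split=> [/eqmodP/asboolP|xy]//; apply/eqmodP/asboolP. Qed.

Lemma quotient_repr_pi x : N ((repr (\pi_quotient_group x))^-1 * x).
Proof. by apply/quotient_piP; rewrite reprK. Qed.

Lemma quotient_mul_pi x y :
  quotient_mul (\pi_quotient_group x) (\pi_quotient_group y) =
  \pi_quotient_group (x * y).
Proof.
have [_ NM _ NJ] := normal_closureP.
apply/quotient_piP; have Nx := NJ _ y (quotient_repr_pi x).
have := NM _ _ (quotient_repr_pi y) Nx; rewrite /=.
move: (repr (\pi x)) (repr (\pi y)) => x' y'.
have -> : (x' * y')^-1 * (x * y) = (y'^-1 * y) * (x'^-1 * x) ^ y.
  by rewrite invgM conjgE !mulgA mulgK.
by [].
Qed.

Lemma quotient_inv_pi x :
  quotient_inv (\pi_quotient_group x) = \pi_quotient_group x^-1.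
Proof.
have [_ _ NV NJ] := normal_closureP.
apply/quotient_piP; have := NJ _ x^-1 (NV _ (quotient_repr_pi x)).
by rewrite invgM invgK conjgE invgK !mulgA mulgV mul1g.
Qed.

Lemma quotient_mulA : associative quotient_mul.
Proof.
elim/quotW=> x; elim/quotW=> y; elim/quotW=> z.
by rewrite (quotient_mul_pi y z) (quotient_mul_pi x y) !quotient_mul_pi mulgA.
Qed.

Lemma quotient_mul1 : left_id quotient_one quotient_mul.
Proof. by elim/quotW=> x; rewrite quotient_mul_pi mul1g. Qed.

Lemma quotient_mulr1 : right_id quotient_one quotient_mul.
Proof. by elim/quotW=> x; rewrite quotient_mul_pi mulg1. Qed.

Lemma quotient_mulV : left_inverse quotient_one quotient_inv quotient_mul.
Proof. by elim/quotW=> x; rewrite quotient_inv_pi quotient_mul_pi mulVg. Qed.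

Lemma quotient_mulrV : right_inverse quotient_one quotient_inv quotient_mul.
Proof. by elim/quotW=> x; rewrite quotient_inv_pi quotient_mul_pi mulgV. Qed.

HB.instance Definition _ := isGroup.Build quotient_group
  quotient_mulA quotient_mul1 quotient_mulr1 quotient_mulV quotient_mulrV.

End QuotientGroup.

Definition simple_graph (V : finType) (E : rel V) : Prop :=
  symmetric E /\ irreflexive E.

Definition graph_relators (V : finType) (E : rel V) (Gv : V -> groupType) :
    set (free_product Gv) :=
  [set r | exists v w (g : Gv v) (h : Gv w),
     E v w /\ r = [~ free_in g, free_in h]].

Definition graph_product (V : finType) (E : rel V) (Gv : V -> groupType) :
    groupType :=
  quotient_group (@graph_relators V E Gv).

Definition splits_as_graph_product (V : finType) (E : rel V)
    (Gv : V -> groupType) (G : groupType) : Prop :=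
  exists2 f : graph_product E Gv -> G,
    {morph f : x y / x * y} & bijective f.

(** [P] is a Polish space: a Hausdorff pseudometric is a metric. *)
Definition standard_borel (R : realType) d (T : measurableType d) : Prop :=
  exists P : completePseudoMetricType R,
    [/\ hausdorff_space P,
        exists2 D : set P, countable D & dense D &
        exists2 f : T -> P, bijective f &
          forall B : set P, <<s open >> B <-> measurable (f @^-1` B)].

Definition is_action (G : groupType) (X : Type) (a : G -> X -> X) : Prop :=
  (forall x, a 1 x = x) /\ (forall g h x, a (g * h) x = a g (a h x)).

Definition orbit_of (G : groupType) (X : Type) (a : G -> X -> X) (x : X) :
    set X :=
  [set a g x | g in [set: G]].

Section MeasurePreservingActions.
Variables (R : realType) (d : measure_display) (X : measurableType d).
Variables (mu : {measure set X -> \bar R}) (G : groupType) (a : G -> X -> X).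

(** Each [a g] is a Borel automorphism, with Borel inverse [a g^-1]. *)
Definition mp_action : Prop :=
  [/\ is_action a,
      forall g, measurable_fun [set: X] (a g) &
      forall g A, measurable A -> pushforward mu (a g) A = mu A].

Definition essentially_free : Prop :=
  {ae mu, forall x, forall g, a g x = x -> g = 1}.

Definition fundamental_domain (D : set X) : Prop :=
  measurable D /\ {ae mu, forall x, exists! y, orbit_of a x y /\ D y}.

End MeasurePreservingActions.

(** Only the restriction of [f] to the conull Borel set [X0] is constrained; for
    actions of countable groups almost every orbit is contained in [X0]. *)
Definition measure_space_iso (R : realType) dX (X : measurableType dX)
    dY (Y : measurableType dY) (mu : {measure set X -> \bar R})
    (nu : {measure set Y -> \bar R}) (f : X -> Y) : Prop :=
  exists (X0 : set X) (Y0 : set Y),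
    [/\ [/\ measurable X0, measurable Y0, mu (~` X0) = 0%E & nu (~` Y0) = 0%E],
        set_bij X0 Y0 f,
        measurable_fun X0 f,
        forall A, measurable A -> A `<=` X0 -> measurable (f @` A) &
        forall B, measurable B -> mu (X0 `&` f @^-1` B) = nu B].

Definition orbit_equivalent (R : realType) dX (X : measurableType dX)
    dY (Y : measurableType dY) (mu : {measure set X -> \bar R})
    (nu : {measure set Y -> \bar R}) (G H : groupType)
    (a : G -> X -> X) (b : H -> Y -> Y) : Prop :=
  exists2 f : X -> Y, measure_space_iso mu nu f &
    {ae mu, forall x, f @` orbit_of a x = orbit_of b (f x)}.

Definition admit_orbit_equivalent_free_actions (R : realType)
    (G H : groupType) : Prop :=
  exists (dX dY : measure_display)
    (X : measurableType dX) (Y : measurableType dY)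
    (mu : probability X R) (nu : probability Y R)
    (a : G -> X -> X) (b : H -> Y -> Y),
    [/\ standard_borel R X /\ standard_borel R Y,
        mp_action mu a /\ essentially_free mu a,
        mp_action nu b /\ essentially_free nu b &
        orbit_equivalent mu nu a b].

Definition measure_equivalent (R : realType) (G H : groupType) : Prop :=
  exists (d : measure_display) (S : measurableType d)
    (mu : {measure set S -> \bar R}) (a : G * H -> S -> S),
    let aG g := a (g, 1) in
    let aH h := a (1, h) in
    [/\ standard_borel R S,
        sigma_finite [set: S] mu /\ mu [set: S] <> 0%E,
        mp_action mu a,
        essentially_free mu aG /\
          (exists2 D, fundamental_domain mu aG D & (mu D < +oo)%E) &
        essentially_free mu aH /\
          (exists2 D, fundamental_domain mu aH D & (mu D < +oo)%E)].

(* Main.v *)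
Require Import Defs.
From HB Require Import structures.
From mathcomp Require Import all_boot all_order all_algebra generic_quotient.
From mathcomp Require Import zify ring lra.
From mathcomp Require Import all_classical all_reals all_analysis.

(** Let [X_v] carry the actions of [G_v] and [H_v] with the same orbits.
    Killing the other vertex groups makes [G] act on [X_v] through [G_v]; let
    [X] be the product of the [X_v] with a free Bernoulli shift of [G]. Then
    [G] acts freely on [X], and [H_v] acts on [X] by [h.x = C_v(h, x_v).x],
    where [C_v] is the orbit cocycle with values in [G_v]. As [C_v] ignores
    the coordinates [x_w], [w <> v], these actions commute for adjacent
    vertices, so they define an action of [H], given by a cocycle [c : H * X
    -> G]. Exchanging [G] and [H] inverts [h |-> c(h, x)], so it is a
    bijection for almost every [x]; hence the action of [H] is free with the
    orbits of [G], and the identity of [X] is an orbit equivalence. On [X *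
    G], the commuting actions [h(x,k) = (hx, c(h,x)k)] and [g(x,k) = (x,
    kg^-1)] have the common fundamental domain [X * {1}]. *)

Set Implicit Arguments.
Unset Strict Implicit.
Unset Printing Implicit Defensive.

Import Order.TTheory GRing.Theory Num.Theory.

Local Open Scope classical_set_scope.
Local Open Scope quotient_scope.
Local Open Scope ring_scope.

(** * Graph products and cocycles *)

Local Open Scope group_scope.

(** The factors [X_v] alone do not give a free action: on their product, [G] acts through the direct
    product of the vertex groups. The Bernoulli factor restores freeness, and the vertex cocycles do
    not see it. The obstacle that shapes the proof is the null sets. The universal property turns
    commuting maps into an action only when the relations hold at every point, whereas an orbit
    equivalence gives them almost everywhere. The orbit cocycles are therefore normalized so that
    their identities, and their invariance under the other vertex groups, hold everywhere.
    Bijectivity, like freeness, remains an almost everywhere statement. Since [G] is countable,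
    almost every [x] has bijective vertex cocycles along its whole orbit, and the inversion argument
    is run on that orbit, parametrized by [G]. *)

Section WordAction.
Variables (I : choiceType) (K : I -> groupType) (Y : Type).
Variable b : forall i, K i -> Y -> Y.
Hypothesis b_action : forall i, is_action (@b i).

Definition word_act (s : seq {i : I & K i}) (y : Y) : Y :=
  foldr (fun l => b (tagged l)) y s.

Lemma word_act_cong s t : free_cong s t -> word_act s =1 word_act t.
Proof.
elim=> {s t} [//|s t _ IH y|s t u _ IH1 _ IH2 y|s t i y|s t i g h y].
- by rewrite IH.
- by rewrite IH1 IH2.
- by rewrite /word_act !foldr_cat /= (b_action i).1.
- by rewrite /word_act !foldr_cat /= (b_action i).2.
Qed.

Definition free_act (x : free_product K) : Y -> Y := word_act (repr x).

Lemma free_act_pi s y : free_act (\pi_(free_product K) s) y = word_act s y.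
Proof. exact: word_act_cong (free_repr_pi s) y. Qed.

Lemma free_act_action : is_action free_act.
Proof.
split=> [y|x x' y]; first exact: free_act_pi.
rewrite -[x]reprK -[x']reprK; move: (repr x) (repr x') => s t.
rewrite (_ : _ * _ = \pi_(free_product K) (s ++ t)); last exact: free_mul_pi.
by rewrite !free_act_pi /word_act foldr_cat.
Qed.

Lemma free_act_in i (g : K i) y : free_act (free_in g) y = b g y.
Proof. exact: free_act_pi. Qed.

Lemma free_product_ind (P : free_product K -> Prop) :
  P 1 -> (forall i (g : K i) x, P x -> P (free_in g * x)) -> forall x, P x.
Proof.
move=> P1 PM; elim/quotW; elim=> [|[i g] s IH]; first exact: P1.
have := PM i g _ IH; rewrite [_ * _](free_mul_pi [:: Tagged K g] s); exact.
Qed.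

End WordAction.

Section ActionFacts.
Variables (K : groupType) (Y : Type) (b : K -> Y -> Y).
Hypothesis b_action : is_action b.

Lemma actionK g : cancel (b g) (b g^-1).
Proof. by move=> y; rewrite -b_action.2 mulVg b_action.1. Qed.

Lemma actionVK g : cancel (b g^-1) (b g).
Proof. by move=> y; rewrite -b_action.2 mulgV b_action.1. Qed.

Lemma action_inj g : injective (b g). Proof. exact: can_inj (actionK g). Qed.

(** The elements acting trivially form a normal subgroup; once it contains [R] it contains the
    normal closure, so the action descends. *)
Lemma quotient_act (R : set K) : (forall r, R r -> forall y, b r y = y) ->
  exists2 c : quotient_group R -> Y -> Y,
    is_action c & forall g y, c (\pi_(quotient_group R) g) y = b g y.
Proof.
move=> triv; have trivN r : normal_closure R r -> forall y, b r y = y.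
  move/(_ [set g | forall y, b g y = y]); apply; split=> //=.
  split=> /= [y|g h bg bh y|g bg y|g h bg y].
  - exact: b_action.1.
  - by rewrite b_action.2 bh bg.
  - by rewrite -{1}(bg y) actionK.
  - by rewrite conjgE !b_action.2 bg -b_action.2 mulVg b_action.1.
pose c (q : quotient_group R) := b (repr q).
have cE g y : c (\pi_(quotient_group R) g) y = b g y.
  rewrite /c; have := trivN _ (@quotient_repr_pi K R g).
  by move=> /(_ y); rewrite b_action.2 => /(canRL (actionVK _)) ->.
exists c => //; split=> [y|p q y]; first by rewrite [LHS]cE b_action.1.
rewrite -[p]reprK -[q]reprK; move: (repr p) (repr q) => g h.
rewrite (_ : _ * _ = \pi_(quotient_group R) (g * h)); last first.
  exact: quotient_mul_pi.
by rewrite !cE b_action.2.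
Qed.

End ActionFacts.

(** The universal property is stated for actions on arbitrary types, which
    covers homomorphisms to any group through its left regular action. *)
Record presentation (V : finType) (E : rel V) (Gv : V -> groupType)
    (G : groupType) (i : forall v, Gv v -> G) : Prop := Presentation {
  pres_mul : forall v, {morph @i v : g h / g * h};
  pres_comm : forall v w (g : Gv v) (h : Gv w),
    E v w -> commute (i v g) (i w h);
  pres_ind : forall P : G -> Prop,
    P 1 -> (forall v (g : Gv v) x, P x -> P (i v g * x)) -> forall x, P x;
  pres_act : forall (Y : Type) (b : forall v, Gv v -> Y -> Y),
    (forall v, is_action (b v)) ->
    (forall v w (g : Gv v) (h : Gv w) y, E v w ->
      b v g (b w h y) = b w h (b v g y)) ->
    exists2 c : G -> Y -> Y, is_action c & forall v g y, c (i v g) y = b v g y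
}.

(** For the universal property, the free product acts letter by letter, and the commutation of
    adjacent vertex actions makes every relator act trivially. *)
Lemma graph_product_presentation (V : finType) (E : rel V)
    (Gv : V -> groupType) :
  @presentation V E Gv (graph_product E Gv)
    (fun v (g : Gv v) => \pi_(graph_product E Gv) (free_in g)).
Proof.
have piM x y : \pi_(graph_product E Gv) (x * y) =
    \pi_(graph_product E Gv) x * \pi_(graph_product E Gv) y.
  by rewrite -(quotient_mul_pi (@graph_relators V E Gv)).
split.
- move=> v g h; rewrite -piM; congr (\pi_(graph_product E Gv) _).
  apply/esym; rewrite /free_in; apply: etrans (free_mul_pi _ _) _.
  by apply/free_piP; exact: (free_cong_mul [::]).
- move=> v w g h vw; rewrite /commute -!piM.
  apply/esym/quotient_piP => N [_ RN]; apply: RN.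
  exists v, w, g, h; split=> //.
  by rewrite commgEl conjgE invgM !mulgA.
- move=> P P1 PM; elim/quotW; apply: free_product_ind => //.
  by move=> v g x Px; rewrite piM; exact: PM.
- move=> Y b bA bC.
  have FA := free_act_action bA; set F := free_act b in FA.
  have FE v (g : Gv v) y : F (free_in g) y = b v g y by exact: free_act_in.
  have [|c cA cE] := @quotient_act _ _ F FA (@graph_relators V E Gv).
    move=> _ [v [w [g [h [vw ->]]]]] y.
    by rewrite commgEl conjgE !FA.2 !FE bC// -!FE !actionK.
  by exists c => // v g y; rewrite -FE; exact: cE.
Qed.

Lemma splits_presentation (V : finType) (E : rel V) (Gv : V -> groupType)
    (G : groupType) :
  splits_as_graph_product E Gv G ->
  exists i : forall v, Gv v -> G, presentation E i.
Proof.
move=> [f fM [f' fK f'K]].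
have [pM pC pI pA] := graph_product_presentation E Gv.
have f1 : f 1 = 1 by apply: (mulgI (f 1)); rewrite -fM !mulg1.
exists (fun v (g : Gv v) => f (\pi_(graph_product E Gv) (free_in g))).
split.
- by move=> v g h; rewrite -fM pM.
- by move=> v w g h vw; rewrite /commute -!fM pC.
- move=> P P1 PM x; rewrite -[x]f'K; elim/pI: (f' x); first by rewrite f1.
  by move=> v g y; rewrite fM; exact: PM.
- move=> Y b bA bC; have [c cA cE] := pA _ _ bA bC.
  exists (c \o f') => [|v g y]; last by rewrite /= fK cE.
  split=> [y|x x' y] /=; first by rewrite -f1 fK cA.1.
  by rewrite -cA.2; congr (c _ _); apply: (can_inj fK); rewrite fM !f'K.
Qed.

(** A total [decode], with default value [x0], turns unions over a countable group into unions over
    [nat], the form used for countable additivity. *)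
Lemma countable_code (T : choiceType) (x0 : T) : countable [set: T] ->
  exists (code : T -> nat) (decode : nat -> T), cancel code decode.
Proof.
move=> /countable_injP[f fI]; exists f.
exists (fun n => xget x0 [set x | f x = n]) => x; apply: fI; rewrite ?inE//.
by rewrite (@xgetPex _ x0 [set y | f y = f x])//; exists x.
Qed.

Lemma countable_seq (T : Type) : countable [set: T] -> countable [set: seq T].
Proof.
move=> /countable_injP[f fI]; apply/countable_injP.
exists (pickle \o map f) => s t _ _ /(pcan_inj pickleK); apply: inj_map => x y.
by apply: fI; rewrite inE.
Qed.

Lemma presentation_countable (V : finType) (E : rel V) (Gv : V -> groupType)
    (G : groupType) (i : forall v, Gv v -> G) : presentation E i ->
  (forall v, countable [set: Gv v]) -> countable [set: G].
Proof.
move=> pG cG; pose ev (s : seq {v : V & Gv v}) : G :=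
  foldr (fun l x => i (tag l) (tagged l) * x) 1 s.
have -> : [set: G] = range ev.
  apply/seteqP; split=> // x _; elim/(pres_ind pG): x => [|v g x [s _ sx]].
    by exists [::].
  by exists (Tagged Gv g :: s); rewrite //= -/(ev s) sx.
apply: sub_countable (card_image_le _ _) _; apply: countable_seq.
have -> : [set: {v : V & Gv v}] =
    \bigcup_(v in [set: V]) (Tagged Gv @` [set: Gv v]).
  by apply/seteqP; split=> // -[v g] _; exists v => //; exists g.
apply: bigcup_countable => [|v _]; first exact: countableP.
exact: sub_countable (card_image_le _ _) (cG v).
Qed.

(** The cocycle equation over the action [h.y = a (c h y) y] of [H]. That action is not part of the
    data: the equation makes it one as soon as [a] is an action. *)
Definition cocycle (H G : groupType) (Y : Type) (a : G -> Y -> Y)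
    (c : H -> Y -> G) : Prop :=
  (forall y, c 1 y = 1) /\
  (forall h k y, c (h * k) y = c h (a (c k y) y) * c k y).

(** * Extension of cocycles from the vertex groups *)

Section Cocycles.
Variables (V : finType) (E : rel V) (Eirr : irreflexive E).

(** Each [Hv v] acts on the skew product [Y * G], recording in the second coordinate the element of
    [G] that moves the first. For adjacent vertices these actions commute, because each cocycle
    ignores the move made by the other and the images of the vertex groups commute in [G]. The
    universal property yields one action of [H], and [c h y] is the element it records from
    [(y, 1)]. *)
Lemma cocycle_extension (Gv Hv : V -> groupType) (G H : groupType)
    (iG : forall v, Gv v -> G) (iH : forall v, Hv v -> H) (Y : Type)
    (a : G -> Y -> Y) (C : forall v, Hv v -> Y -> Gv v) :
  presentation E iG -> presentation E iH -> is_action a ->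
  (forall v, cocycle (fun g => a (iG v g)) (C v)) ->
  (forall v w h g y, w != v -> C v h (a (iG w g) y) = C v h y) ->
  exists2 c : H -> Y -> G,
    cocycle a c & forall v h y, c (iH v h) y = iG v (C v h y).
Proof.
move=> pG pH [a1 aM] CC Cinv.
pose b v (h : Hv v) (p : Y * G) : Y * G :=
  (a (iG v (C v h p.1)) p.1, iG v (C v h p.1) * p.2).
have i1 v : iG v 1 = 1.
  by apply: (mulgI (iG v 1)); rewrite -(pres_mul pG) !mulg1.
have [|v w h k [y x] vw|t [t1 tM] tE] := pres_act pH (b := b).
- move=> v; split=> [[y x]|h k [y x]]; rewrite /b /=.
    by rewrite (CC v).1 i1 a1 mul1g.
  by rewrite (CC v).2 /= (pres_mul pG) aM mulgA.
- have wv : w != v by apply: contraTneq vw => ->; rewrite Eirr.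
  have vw' : v != w by rewrite eq_sym.
  rewrite /b /= !Cinv// -!aM !mulgA.
  by have -> := pres_comm pG (C v h y) (C w k y) vw.
(* Every [h] acts on the second coordinate by a left multiplication depending only on [y], and on
   the first by the same element; so the values at [(y, 1)] determine the action. *)
- have tc : forall h y x, t h (y, x) =
      (a (t h (y, 1)).2 y, (t h (y, 1)).2 * x).
    elim/(pres_ind pH) => [y x|v h k IH y x]; first by rewrite !t1 a1 mul1g.
    have {}IH z : t k (y, z) = (a (t k (y, 1)).2 y, (t k (y, 1)).2 * z).
      exact: IH.
    move: (t k (y, 1)).2 IH => q IH.
    by rewrite !tM !tE !IH /b /= aM mulg1 mulgA.
  exists (fun h y => (t h (y, 1)).2) => [|v h y]; last first.
    by rewrite tE /b /= mulg1.
  split=> [y|h k y]; first by rewrite t1.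
  by rewrite tM [t k (y, 1)]tc mulg1 tc.
Qed.

(** The inverses of the maps [C v ^~ y] satisfy the hypotheses of
    [cocycle_extension] with [G] and [H] exchanged, and the resulting map is a
    left inverse of [c]. This avoids the normal form theorem. *)
Lemma cocycle_extension_bij (Gv Hv : V -> groupType) (G H : groupType)
    (iG : forall v, Gv v -> G) (iH : forall v, Hv v -> H) (Y : Type)
    (a : G -> Y -> Y) (C : forall v, Hv v -> Y -> Gv v) (c : H -> Y -> G) :
  presentation E iG -> presentation E iH -> is_action a ->
  (forall v, cocycle (fun g => a (iG v g)) (C v)) ->
  (forall v w h g y, w != v -> C v h (a (iG w g) y) = C v h y) ->
  cocycle a c -> (forall v h y, c (iH v h) y = iG v (C v h y)) ->
  (forall v y, bijective (C v ^~ y)) ->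
  forall y, bijective (c ^~ y).
Proof.
move=> pG pH aA CC Cinv [c1 cM] cE Cbij.
have DP v y : exists D, cancel (C v ^~ y) D /\ cancel D (C v ^~ y).
  by have [D] := Cbij v y; exists D.
pose D v (g : Gv v) y := projT1 (cid (DP v y)) g.
have CD v g y : C v (D v g y) y = g.
  by rewrite /D; case: (cid _) => /= d [_ ->].
have DC v h y : D v (C v h y) y = h.
  by rewrite /D; case: (cid _) => /= d [->].
pose b h y := a (c h y) y.
have bA : is_action b.
  by split=> [y|h k y]; rewrite /b ?c1 ?aA.1// cM aA.2.
have Cinj v y : injective (C v ^~ y) by have := Cbij v y; exact: bij_inj.
have [|v w g h y wv|d [d1 dM] dE] :=
    @cocycle_extension Hv Gv H G iH iG Y b D pH pG bA.
- move=> v; split=> [y|g k y]; apply: (Cinj v y); rewrite /= CD ?(CC v).1//.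
  by rewrite (CC v).2 /b cE CD CD.
(* The points [b (iH w h) y] and [y] differ by an element of the vertex group at [w], which [C v]
   ignores; hence the inverse [D v] of [C v] is the same at both points. *)
- by apply: (Cinj v y); rewrite /= CD -(Cinv v w _ (C w h y) y wv) -cE CD.
have dc h y : d (c h y) y = h.
  elim/(pres_ind pH): h y => [y|v h k IH y]; first by rewrite c1 d1.
  have {}IH : d (c k y) y = k := IH y.
  by rewrite cM cE dM IH dE DC.
move=> y; exists (d ^~ y) => [h|g] /=; first exact: dc.
elim/(pres_ind pG): g y => [y|v g k IH y]; first by rewrite d1 c1.
have {}IH : c (d k y) y = k := IH y.
by rewrite dM dE cM IH /b IH cE CD.
Qed.

End Cocycles.

Local Close Scope group_scope.

(** * Standard Borel spaces and measure-preserving maps *)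

HB.instance Definition _ (P Q : puniformType) := Pointed.on (P * Q)%type.

Section ProdComplete.
Variables P Q : completeType.

Lemma prod_cauchy_cvg (F : set_system (P * Q)) :
  ProperFilter F -> cauchy F -> [cvg F in (P * Q)%type].
Proof.
move=> FF cF.
have cF1 : cauchy (fst @ F).
  move=> A entA.
  have /cF : entourage [set xy : (P * Q) * (P * Q) | A (xy.1.1, xy.2.1)].
    exists (A, [set: Q * Q]) => [|[[a b] [c d]] [/= Aab _]].
      by split=> //=; exact: filterT.
    by exists ((a, c), (b, d)).
  move=> [[U W] /= [FU FW] UW].
  exists (fst @` U, fst @` W) => /=.
    by split; [apply: filterS FU|apply: filterS FW] => x Ux; exists x.
  by move=> [_ _] [/= [x Ux <-] [y Wy <-]]; exact: (UW (x, y)).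
have cF2 : cauchy (snd @ F).
  move=> A entA.
  have /cF : entourage [set xy : (P * Q) * (P * Q) | A (xy.1.2, xy.2.2)].
    exists ([set: P * P], A) => [|[[a b] [c d]] [/= _ Aab]].
      by split=> //=; exact: filterT.
    by exists ((a, c), (b, d)).
  move=> [[U W] /= [FU FW] UW].
  exists (snd @` U, snd @` W) => /=.
    by split; [apply: filterS FU|apply: filterS FW] => x Ux; exists x.
  by move=> [_ _] [/= [x Ux <-] [y Wy <-]]; exact: (UW (x, y)).
have [p Fp] : exists p, fst @ F --> (p : P).
  by apply/cvg_ex; exact: (@cauchy_cvg P).
have [q Fq] : exists q, snd @ F --> (q : Q).
  by apply/cvg_ex; exact: (@cauchy_cvg Q).
apply/cvg_ex; exists (p, q) => A [[U W] /= [pU qW] UW].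
have FU : F (fst @^-1` U) := Fp _ pU; have FW : F (snd @^-1` W) := Fq _ qW.
by rewrite /nbhs /=; apply: filterS2 FU FW => -[a b] Ua Wb; exact: (UW (a, b)).
Qed.

HB.instance Definition _ := Uniform_isComplete.Build (P * Q)%type prod_cauchy_cvg.
End ProdComplete.
HB.instance Definition _ (R : numDomainType)
  (P Q : completePseudoMetricType R) := Complete.on (P * Q)%type.


Section StandardBorel.
Variable R : realType.

(** Balls of radius [1/(k+1)] around the points of [D], replaced by their interiors because balls
    need not be open here. *)
Lemma separable_basis (P : pseudoMetricType R) (D : set P) :
  countable D -> dense D ->
  exists2 B : nat -> set P, forall n, open (B n) &
    forall x A, nbhs x A -> exists2 n, B n x & B n `<=` A.
Proof.
move=> /countable_injP[f fI] dD.
pose r k : R := k.+1%:R^-1.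
have r0 k : 0 < r k by rewrite invr_gt0 ltr0n.
(* At most one [p] has code [i], so the union is a single interior or empty; this avoids a default
   point. *)
exists (fun n => if unpickle n is Some (i, k) then
  \bigcup_(p in [set p | D p /\ f p = i]) (ball p (r k))° else set0).
  move=> n; case: (unpickle n) => [[i k]|]; last exact: open0.
  by apply: bigcup_open => p _; exact: open_interior.
move=> x A /nbhs_ballP[e /= e0 eA].
have [k rke] : exists k, r k < e / 2.
  exists (Num.truncn (e / 2)^-1); rewrite /r invf_plt ?posrE ?divr_gt0//.
  by rewrite truncnS_gt.
have h0 : 0 < r k / 2 by rewrite divr_gt0.
have xb : (ball x (r k / 2))° !=set0.
  by exists x; apply: nbhs_singleton; exact/nbhs_interior/nbhsx_ballx.
have [p [px Dp]] := dD _ xb (open_interior _).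
exists (pickle (f p, k)); rewrite pickleK.
  exists p => //; apply/nbhs_ballP; exists (r k / 2) => //= y xy.
  by apply: ball_split xy; apply: ball_sym; exact: interior_subset px.
move=> y [q [Dq fqp]]; have -> : q = p by apply: fI; rewrite ?inE.
move=> /interior_subset py; apply: eA; apply: (@ball_split _ _ p).
  apply: le_ball (interior_subset px); rewrite (le_trans _ (ltW rke))//.
  by rewrite ler_pdivrMr// ler_peMr ?ler1n// ltW.
by apply: le_ball py; exact: ltW.
Qed.

Lemma standard_borel_separating d (T : measurableType d) : standard_borel R T ->
  exists2 S : nat -> set T, forall n, measurable (S n) &
    forall x y, x <> y -> exists2 n, S n x & ~ S n y.
Proof.
move=> [P [hP [D cD dD] [f fbij fE]]].
have [B oB BP] := separable_basis cD dD.
exists (fun n => f @^-1` B n) => [n|x y xy].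
  by apply/fE; exact: sub_sigma_algebra.
have [|n Bnx Bny] := BP (f x) (~` [set f y]).
  apply: open_nbhs_nbhs; split; last first.
    by move=> /= /(bij_inj fbij).
  apply: closed_openC; apply: accessible_closed_set1.
  exact: hausdorff_accessible.
by exists n => // Sny; exact: (Bny _ Sny).
Qed.

(** Two values differ exactly when one of countably many measurable sets contains the first and not
    the second, so the complement of the equalizer is a countable union. *)
Lemma measurable_equalizer d d' (T : measurableType d) (U : measurableType d')
    (D : set T) (f g : T -> U) : standard_borel R U ->
  measurable D -> measurable_fun D f -> measurable_fun D g ->
  measurable (D `&` [set x | f x = g x]).
Proof.
move=> /standard_borel_separating[S mS SP] mD mf mg.
have -> : D `&` [set x | f x = g x] = D `\`
    \bigcup_n ((D `&` f @^-1` S n) `\` (D `&` g @^-1` S n)).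
  apply/seteqP; split=> x /=.
    move=> [Dx fgx]; split=> // -[n _ [[_ /= fS] gS]].
    by apply: gS; rewrite -fgx.
  move=> [Dx nS]; split=> //; apply: contrapT => /SP[n fS gS].
  by apply: nS; exists n => //; split=> // -[].
apply: measurableD => //; apply: bigcup_measurable => n _.
by apply: measurableD; [exact: mf|exact: mg].
Qed.

(** Countable bases make every open set of the product a countable union of open rectangles; the
    converse inclusion is the continuity of the projections. *)
Lemma borel_prod (P Q : pseudoPMetricType R) (D : set P) (D' : set Q) :
  countable D -> dense D -> countable D' -> dense D' ->
  <<s (@open (P * Q)%type) >> =
  @measurable _
    (g_sigma_algebraType (@open P) * g_sigma_algebraType (@open Q))%type.
Proof.
move=> cD dD cD' dD'; apply/seteqP; split.
  apply: smallest_sub => [|O oO]; first exact: sigma_algebra_measurable.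
  have [B oB BP] := separable_basis cD dD.
  have [C oC CP] := separable_basis cD' dD'.
  have -> : O = \bigcup_(n in [set n : nat * nat | B n.1 `*` C n.2 `<=` O])
      (B n.1 `*` C n.2).
    apply/seteqP; split=> [x Ox|x [n /= nO] /nO//].
    have : nbhs x O by exact: open_nbhs_nbhs.
    move=> [[U W] /= [/BP[n Bn BU] /CP[m Cm CW]] UW].
    by exists (n, m) => //= y [By Cy]; apply: UW; split; [exact: BU|exact: CW].
  rewrite bigcup_mkcond; apply: countable_bigcupT_measurable => // n.
  case: ifPn => // _; apply: measurableX; exact: sub_sigma_algebra.
rewrite measurable_prod_measurableType; apply: smallest_sub.
  exact: smallest_sigma_algebra.
pose PQ := g_sigma_algebraType (@open (P * Q)%type).
have mfst : measurable_fun setT (fst : PQ -> g_sigma_algebraType (@open P)).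
  apply: (@measurability _ _ PQ (g_sigma_algebraType (@open P)) setT fst
    (@open P)) => // _ [W oW <-]; rewrite setTI.
  by apply: sub_sigma_algebra; apply: open_comp => // x _; exact: cvg_fst.
have msnd : measurable_fun setT (snd : PQ -> g_sigma_algebraType (@open Q)).
  apply: (@measurability _ _ PQ (g_sigma_algebraType (@open Q)) setT snd
    (@open Q)) => // _ [W oW <-]; rewrite setTI.
  by apply: sub_sigma_algebra; apply: open_comp => // x _; exact: cvg_snd.
move=> _ [A mA [B mB <-]]; rewrite -(setTI (_ `*` _)).
have -> : A `*` B = fst @^-1` A `&` snd @^-1` B by [].
rewrite setIIr; apply: (@measurableI _ PQ); [exact: mfst|exact: msnd].
Qed.

Lemma standard_borel_prod d d' (T : measurableType d) (U : measurableType d') :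
  standard_borel R T -> standard_borel R U -> standard_borel R (T * U)%type.
Proof.
move=> [P [hP [D cD dD] [f [f' fK f'K] fE]]].
move=> [Q [hQ [D' cD' dD'] [g [g' gK g'K] gE]]].
exists (P * Q)%type; split.
- move=> [a b] [c e] ab; congr pair; [apply: hP|apply: hQ] => A B pA qB.
    have [|y [/= Ay By]] :=
      ab (fst @^-1` A) (fst @^-1` B) _ (@cvg_fst _ _ _ _ _ _ qB).
      exact: cvg_fst pA.
    by exists y.1.
  have [|y [/= Ay By]] := ab (snd @^-1` A) (snd @^-1` B) _ (cvg_snd qB).
    exact: (cvg_snd pA).
  by exists y.2.
- exists (D `*` D'); first exact: countableX.
  move=> O [x Ox] oO; have : nbhs x O by exact: open_nbhs_nbhs.
  move=> [[U1 U2] /= [U1x U2x] UO].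
  have x1 := nbhs_singleton (nbhs_interior U1x).
  have x2 := nbhs_singleton (nbhs_interior U2x).
  have [|p [pU Dp]] := dD (U1°) _ (open_interior _); first by exists x.1.
  have [|q [qU Dq]] := dD' (U2°) _ (open_interior _); first by exists x.2.
  by exists (p, q); split=> //; apply: UO; split; exact: interior_subset.
- pose BP := g_sigma_algebraType (@open P).
  pose BQ := g_sigma_algebraType (@open Q).
  have mf : measurable_fun setT (f : T -> BP).
    by move=> _ B mB; rewrite setTI; exact/fE.
  have mg : measurable_fun setT (g : U -> BQ).
    by move=> _ B mB; rewrite setTI; exact/gE.
  have mf' : measurable_fun setT (f' : BP -> T).
    move=> _ B mB; rewrite setTI; apply/fE; rewrite -comp_preimage.
    by rewrite (_ : f' \o f = id)//; apply/funext.
  have mg' : measurable_fun setT (g' : BQ -> U).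
    move=> _ B mB; rewrite setTI; apply/gE; rewrite -comp_preimage.
    by rewrite (_ : g' \o g = id)//; apply/funext.
  pose h (x : T * U) : BP * BQ := (f x.1, g x.2).
  pose h' (x : BP * BQ) : T * U := (f' x.1, g' x.2).
  have mh : measurable_fun setT h.
    apply/measurable_fun_pairP; split.
      exact: measurableT_comp mf measurable_fst.
    exact: measurableT_comp mg measurable_snd.
  have mh' : measurable_fun setT h'.
    apply/measurable_fun_pairP; split.
      exact: measurableT_comp mf' measurable_fst.
    exact: measurableT_comp mg' measurable_snd.
  exists h; first by exists h' => -[x y]; rewrite /h /h' /= ?fK ?gK ?f'K ?g'K.
  move=> B; rewrite (borel_prod cD dD cD' dD'); split=> mB.
    by have := mh measurableT B mB; rewrite setTI.
  have := mh' measurableT _ mB; rewrite setTI -comp_preimage.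
  rewrite (_ : h \o h' = id)//.
  by apply/funext => -[x y]; rewrite /h /h' /= f'K g'K.
Qed.

End StandardBorel.

(** An alias that carries the discrete topology and the full sigma-algebra without putting them on
    every group. *)
Definition discrete_group (G : groupType) : Type := G.
HB.instance Definition _ (G : groupType) := Choice.copy (discrete_group G) G.
HB.instance Definition _ (G : groupType) :=
  isPointed.Build (discrete_group G) 1%g.
HB.instance Definition _ (G : groupType) :=
  @isMeasurable.Build default_measure_display (discrete_group G)
    discrete_measurable discrete_measurable0
    discrete_measurableC discrete_measurableU.
HB.instance Definition _ (G : groupType) :=
  hasNbhs.Build (discrete_group G) principal_filter.
HB.instance Definition _ (G : groupType) :=
  Discrete_ofNbhs.Build (discrete_group G) erefl.
HB.instance Definition _ (G : groupType) :=
  DiscreteUniform_ofNbhs.Build (discrete_group G).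
HB.instance Definition _ (R : numDomainType) (G : groupType) :=
  @DiscretePseudoMetric_ofUniform.Build R (discrete_group G).

Lemma discrete_cauchy_cvg (G : groupType) (F : set_system (discrete_group G)) :
  ProperFilter F -> cauchy F -> [cvg F in discrete_group G].
Proof.
move=> FF cF; have /cF : entourage (@diagonal (discrete_group G)).
  by rewrite uniform_discrete => _ [x _ <-].
move=> [[A B] /= [FA FB] AB].
have [x [Ax Bx]] := filter_ex (filterI FA FB).
apply/cvg_ex; exists x; apply/discrete_cvg; apply: filterS FB => y By.
exact/esym/(AB (x, y)).
Qed.

HB.instance Definition _ (G : groupType) :=
  Uniform_isComplete.Build (discrete_group G) (@discrete_cauchy_cvg G).

Lemma standard_borel_discrete (R : realType) (G : groupType) :
  countable [set: G] -> standard_borel R (discrete_group G).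
Proof.
move=> cG; exists (discrete_group G); split.
- exact: discrete_hausdorff.
- by exists setT => // A [x Ax] _; exists x.
- exists id; first by exists id.
  by move=> B; split=> // _; apply: sub_sigma_algebra; exact: discrete_open.
Qed.

Definition preserves (R : realType) d (T : measurableType d)
    (m : set T -> \bar R) (f : T -> T) : Prop :=
  measurable_fun setT f /\ forall A, measurable A -> m (f @^-1` A) = m A.

Section Preserves.
Context (R : realType) d (T : measurableType d) d' (U : measurableType d').

Lemma preserves_id (m : set T -> \bar R) : preserves m id.
Proof. by split. Qed.

Lemma preserves_comp (m : set T -> \bar R) (f g : T -> T) :
  preserves m f -> preserves m g -> preserves m (f \o g).
Proof.
move=> [mf fm] [mg gm]; split; first exact: measurableT_comp.
move=> A mA; rewrite comp_preimage gm ?fm//.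
by have := mf measurableT A mA; rewrite setTI.
Qed.

(** The image of the product measure agrees with it on rectangles, and a product of sigma-finite
    measures is determined by them. *)
Lemma preserves_prod (m : {sigma_finite_measure set T -> \bar R})
    (n : {sigma_finite_measure set U -> \bar R}) (f : T -> T) (g : U -> U) :
  preserves m f -> preserves n g ->
  preserves (m \x n)%E (fun z => (f z.1, g z.2)).
Proof.
move=> [mf fm] [mg gm]; set h := fun _ => _.
have mh : measurable_fun setT h.
  apply/measurable_fun_pairP; split.
    exact: measurableT_comp mf measurable_fst.
  exact: measurableT_comp mg measurable_snd.
split=> // A mA.
pose mn := measure_function_pushforward__canonical__measure_function_Measure
  (m \x n)%E mh.
apply/esym; rewrite (product_measure_unique (m' := mn))//.
move=> B C mB mC; rewrite /mn /= /pushforward.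
have -> : h @^-1` (B `*` C) = (f @^-1` B) `*` (g @^-1` C) by [].
rewrite product_measure1E.
- by congr (_ * _)%E; [exact: fm|exact: gm].
- by have := mf measurableT B mB; rewrite setTI.
- by have := mg measurableT C mC; rewrite setTI.
Qed.

End Preserves.

Lemma counting_bij (R : realType) (T : choiceType) (f f' : T -> T) (A : set T) :
  cancel f f' -> cancel f' f -> @counting T R (f @^-1` A) = counting A.
Proof.
move=> fK f'K; have preE B : f @^-1` B = f' @` B.
  apply/seteqP; split=> [x Bx|_ [y By <-]] /=; last by rewrite f'K.
  by exists (f x).
rewrite preE /counting; have [fA|nA] := pselect (finite_set A); last first.
  rewrite !asboolF// => /(finite_image f); rewrite image_comp.
  by rewrite (_ : f \o f' = id) ?image_id//; apply/funext.
have fA' : finite_set (f' @` A) by exact: finite_image.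
rewrite !asboolT//; congr (_%:R%:E).
by rewrite fset_set_image// finmap.card_imfset//; exact: can_inj f'K.
Qed.

Lemma discrete_group_sigma_finite (R : realType) (G : groupType) :
  countable [set: G] -> sigma_finite setT (@counting (discrete_group G) R).
Proof.
move=> /countable_injP[f fI]; exists (fun n => [set x | f x = n]).
  by apply/seteqP; split=> // x _; exists (f x).
move=> n; split=> //; rewrite /counting asboolT ?ltry//.
have [->|/set0P[x fx]] := eqVneq [set x | f x = n] set0.
  exact: finite_set0.
apply: sub_finite_set (finite_set1 x) => y /= fy.
by apply: fI; rewrite ?inE// fy.
Qed.

Section Pieces.
Context (R : realType) d (T : measurableType d).
Variables (m : {measure set T -> \bar R}) (G : groupType) (a : G -> T -> T).
Hypotheses (aA : is_action a) (aP : forall g, preserves m (a g)).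
Hypothesis cG : countable [set: G].

Lemma measure_partition (D : nat -> set T) (A : set T) :
  (forall n, measurable (D n)) -> trivIset setT D -> \bigcup_n D n = setT ->
  measurable A -> m A = (\sum_(n <oo) m (A `&` D n))%E.
Proof.
move=> mD tD cD mA; rewrite -[in LHS](setIT A) -cD setI_bigcupr.
rewrite measure_bigcup//; last exact: trivIset_setIl.
- by apply: eq_eseriesl => n; rewrite in_setT.
- by move=> n _; exact: measurableI.
Qed.

(** On each piece where [k] is constant the map is a translation, so the piece keeps its measure; by
    bijectivity the images of the pieces form another partition, and countable additivity concludes.
    An action of [H] through a cocycle with values in [G] has this form. *)
Lemma preserves_piecewise (k : T -> G) :
  (forall g, measurable (k @^-1` [set g])) ->
  bijective (fun x => a (k x) x) -> preserves m (fun x => a (k x) x).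
Proof.
move=> mk [f' fK f'K]; set f := fun x => _ in fK f'K *.
have [code [decode codeK]] := countable_code 1%g cG.
pose D n := [set x | code (k x) = n].
have mD n : measurable (D n).
  have [cd|ncd] := pselect (code (decode n) = n).
    rewrite (_ : D n = k @^-1` [set decode n])//; apply/seteqP; split=> x /=.
      by move=> <-; rewrite codeK.
    by rewrite /D /= => ->.
  rewrite (_ : D n = set0)//; apply/seteqP; split=> // x /= Dx; apply: ncd.
  by rewrite -Dx codeK.
have kD n x : D n x -> k x = decode n by move=> <-; rewrite codeK.
have tD : trivIset setT D.
  by apply/trivIsetP => i j _ _; apply: contraNeq => /set0P[x [<- <-]].
have cD : \bigcup_n D n = setT.
  by apply/seteqP; split=> // x _; exists (code (k x)).
have ma g A : measurable A -> measurable (a g @^-1` A).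
  by move=> mA; have := (aP g).1 measurableT A mA; rewrite setTI.
have mf A : measurable A -> measurable (f @^-1` A).
  move=> mA; rewrite -[_ @^-1` _]setIT -cD setI_bigcupr.
  apply: bigcupT_measurable => n.
  rewrite (_ : _ `&` _ = (a (decode n) @^-1` A) `&` D n); last first.
    apply/seteqP; split=> x [/= Ax Dx]; split=> //; move: Ax;
    by rewrite /f (kD _ _ Dx).
  by apply: measurableI => //; exact: ma.
split=> [_ A mA|A mA]; first by rewrite setTI; exact: mf.
(* The image of the piece [D n], written as a preimage so that its measurability is immediate. *)
pose E n := a (decode n)^-1%g @^-1` D n.
have fE n y : E n y -> f (a (decode n)^-1%g y) = y.
  by move=> Ey; rewrite /f (kD _ _ Ey) actionVK.
rewrite (measure_partition mD tD cD (mf _ mA)).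
rewrite (@measure_partition E A)//.
- apply: eq_eseriesr => n _.
  rewrite (_ : _ `&` _ = a (decode n) @^-1` (A `&` E n)).
    by apply: (aP _).2; apply: measurableI => //; exact: ma.
  apply/seteqP; split=> x /=; rewrite /E /= actionK// => -[Ax Dx].
    by split=> //; rewrite -(kD _ _ Dx).
  by split=> //; rewrite /f (kD _ _ Dx).
- by move=> n; exact: ma.
- apply/trivIsetP => i j _ _; apply: contraNeq => /set0P[y [Ei Ej]].
  have xx : a (decode i)^-1%g y = a (decode j)^-1%g y.
    by apply: (can_inj fK); rewrite !fE.
  by apply/eqP; transitivity (code (k (a (decode i)^-1%g y))); [|rewrite xx].
- apply/seteqP; split=> // y _; exists (code (k (f' y))) => //.
  rewrite /E /= codeK (_ : a _ y = f' y)//.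
  apply: (action_inj aA (g := k (f' y))).
  by rewrite actionVK//; exact/esym/f'K.
Qed.

End Pieces.

(** * The cocycle of an orbit equivalence *)

Lemma inj_surj_bijective (T U : Type) (f : T -> U) :
  injective f -> (forall u, exists t, f t = u) -> bijective f.
Proof.
move=> fI fS; exists (fun u => projT1 (cid (fS u))) => [t|u].
  by apply: fI; case: cid.
by case: cid.
Qed.

Lemma orbit_cocycle (R : realType) (G H : groupType) :
  countable [set: G] -> admit_orbit_equivalent_free_actions R G H ->
  exists (d : measure_display) (X : measurableType d) (mu : probability X R)
    (a : G -> X -> X) (C : H -> X -> G),
    [/\ standard_borel R X, is_action a /\ (forall g, preserves mu (a g)),
        cocycle a C, forall h g, measurable (C h @^-1` [set g]) &
        {ae mu, forall x, bijective (C ^~ x)}].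
Proof.
move=> cG [dX [dY [X [Y [mu [nu [a [b]]]]]]]].
move=> [[sX sY] [[aA ma amu] [Na [mNa Na0 Nafree]]]].
move=> [[bA mb _] [Nb [mNb Nb0 Nbfree]]].
move=> [f [X0 [Y0 [[mX0 mY0 X00 Y00] [fX0 fI _] mf _ fmu]]]].
move=> [No [mNo No0 Noorb]].
have aP g : preserves mu (a g) by split=> // A mA; exact: amu.
have ma' g A : measurable A -> measurable (a g @^-1` A).
  by move=> mA; have := ma g measurableT A mA; rewrite setTI.
have [code [decode codeK]] := countable_code 1%g cG.
(* All the exceptional sets, on the side of [X]; the last one is cut with [X0], where [f] is known
   to be measurable. *)
pose N := ~` X0 `|` Na `|` No `|` (X0 `&` f @^-1` Nb).
have mN : measurable N.
  by repeat apply: measurableU => //; [exact: measurableC|exact: mf].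
have N0 : mu N = 0%E.
  apply: null_set_setU => //; last by rewrite fmu.
  - by repeat apply: measurableU => //; exact: measurableC.
  - exact: mf.
  - apply: null_set_setU => //.
      by apply: measurableU => //; exact: measurableC.
    by apply: null_set_setU => //; exact: measurableC.
pose B := [set x | forall g, ~ N (a g x)].
have BE : B = ~` \bigcup_n (a (decode n) @^-1` N).
  rewrite setC_bigcup; apply/seteqP; split=> x /= Bx.
    by move=> n _; exact: Bx.
  by move=> g; have := Bx (code g) I; rewrite /= codeK.
have mBC : measurable (\bigcup_n (a (decode n) @^-1` N)).
  by apply: bigcupT_measurable => n; exact: ma'.
have mB : measurable B by rewrite BE; exact: measurableC.
have B0 : mu (~` B) = 0%E.
  rewrite BE setCK; apply/measure_negligible => //.
  apply: negligible_bigcup => n; exists (a (decode n) @^-1` N); split=> //.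
    exact: ma'.
  exact: etrans ((aP _).2 _ mN) N0.
have Ba g x : B x -> B (a g x) by move=> Bx k; rewrite -aA.2; exact: Bx.
have BN x : B x -> ~ N x by move=> /(_ 1%g); rewrite aA.1.
have BX0 x : B x -> X0 x.
  by move=> /BN Nx; apply: contrapT => nX0; apply: Nx; left; left; left.
have Bfree x : B x -> forall g, a g x = x -> g = 1%g.
  move=> /BN Nx; apply: contrapT => nf; apply: Nx; left; left; right.
  exact: Nafree.
have Borb x : B x -> f @` orbit_of a x = orbit_of b (f x).
  move=> /BN Nx; apply: contrapT => nf; apply: Nx; left; right.
  exact: Noorb.
have Bfreeb x : B x -> forall h, b h (f x) = f x -> h = 1%g.
  move=> Bx; have Nx := BN _ Bx; apply: contrapT => nf; apply: Nx; right.
  by split; [exact: BX0|exact: Nbfree].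
(* The default value [1] off the invariant conull set [B] makes the cocycle
   identity hold everywhere. *)
pose C h x : G :=
  if pselect (B x) then xget 1%g [set g | f (a g x) = b h (f x)] else 1%g.
have CnB h x : ~ B x -> C h x = 1%g by rewrite /C; case: pselect.
have CB h x : B x -> f (a (C h x) x) = b h (f x).
  move=> Bx; rewrite /C; case: (pselect (B x)) => //= _.
  have : orbit_of b (f x) (b h (f x)) by exists h.
  rewrite -Borb//; case=> _ [g _ <-] fg.
  exact: (@xgetPex _ 1%g [set g | f (a g x) = b h (f x)]) (ex_intro _ g fg).
have Bfa x g g' : B x -> f (a g x) = f (a g' x) -> g = g'.
  move=> Bx fgg'; have agg' : a g x = a g' x.
    by apply: fI; rewrite ?inE//; apply: BX0; exact: Ba.
  have /(Bfree _ Bx) : a (g'^-1 * g)%g x = x by rewrite aA.2 agg' actionK.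
  by move=> /(congr1 (fun z => g' * z)%g); rewrite mulVKg mulg1.
have Bfb x h h' : B x -> b h (f x) = b h' (f x) -> h = h'.
  move=> Bx hh'; have /(Bfreeb _ Bx) : b (h'^-1 * h)%g (f x) = f x.
    by rewrite bA.2 hh' actionK.
  by move=> /(congr1 (fun z => h' * z)%g); rewrite mulVKg mulg1.
exists dX, X, mu, a, C; split=> //.
- split=> [x|h k x]; have [Bx|nBx] := pselect (B x).
  + by apply: (Bfa x) => //; rewrite CB// bA.1 aA.1.
  + exact: CnB.
  + apply: (Bfa x) => //; rewrite CB// bA.2 aA.2 CB ?CB//; exact: Ba.
  + by rewrite !CnB ?mulg1// aA.1.
- move=> h g; have mEq : measurable (B `&` [set x | f (a g x) = b h (f x)]).
    have mfB : measurable_fun B f by exact: measurable_funS mf.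
    apply: (measurable_equalizer sY) => //.
      apply: (@measurable_comp _ _ _ _ _ _ B f B (a g)) => //.
        by move=> _ [x Bx <-]; exact: Ba.
      exact: measurable_funTS (ma g).
    exact: (@measurableT_comp _ _ _ _ _ _ (b h) B f (mb h)).
  (* On [B] the defining equation characterizes the value [g]; off [B] the value is [1], so that
     part is the whole complement of [B] or empty. *)
  rewrite (_ : _ @^-1` _ = (B `&` [set x | f (a g x) = b h (f x)]) `|`
      (~` B `&` [set x | g = 1%g])); last first.
    apply/seteqP; split=> x /=.
      move=> <-; have [Bx|nBx] := pselect (B x);
      by [left; rewrite CB|right; rewrite CnB].
    by move=> [[Bx fg]|[nBx ->]]; [apply: (Bfa x) => //; rewrite CB|exact: CnB].
  apply: measurableU => //; apply: measurableI; first exact: measurableC.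
  have [->|ng] := pselect (g = 1%g).
    by rewrite (_ : [set _ | _] = setT)//; apply/seteqP.
  by rewrite (_ : [set _ | _] = set0)//; apply/seteqP; split.
- exists (~` B); split=> //; first exact: measurableC.
  apply: subsetC => x Bx /=; apply: inj_surj_bijective => [h h'|g].
    by move=> /= CC; apply: (Bfb x) => //; rewrite -!CB// CC.
  have : (f @` orbit_of a x) (f (a g x)) by exists (a g x) => //; exists g.
  rewrite Borb// => -[h _ fh]; exists h; apply: (Bfa x) => //.
  by rewrite CB.
Qed.

(** * Bernoulli shifts *)

(** The Cantor space, under its own name to carry the uniformity in which points are close when they
    share a long prefix. *)
Definition bits : Type := nat -> bool.

HB.instance Definition _ := gen_eqMixin bits.
HB.instance Definition _ := gen_choiceMixin bits.
HB.instance Definition _ := isPointed.Build bits (fun=> false).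

Definition cyl (n : nat) (x : bits) : set bits :=
  [set y | forall k, (k < n)%N -> x k = y k].

Lemma cyl_sym n x y : cyl n x y -> cyl n y x.
Proof. by move=> xy k /xy. Qed.

Lemma cyl_trans n x y z : cyl n x y -> cyl n y z -> cyl n x z.
Proof. by move=> xy yz k kn; rewrite xy ?yz. Qed.

Lemma cyl_le n m x : (m <= n)%N -> cyl n x `<=` cyl m x.
Proof. by move=> mn y xy k km; apply: xy; exact: leq_trans mn. Qed.

Lemma cyl_eq n x y : cyl n x y -> cyl n x = cyl n y.
Proof.
move=> xy; apply/seteqP; split=> z; first exact/cyl_trans/cyl_sym.
exact: cyl_trans.
Qed.

Section BitsUniform.
Local Open Scope relation_scope.

Definition bits_ent : set_system (bits * bits) :=
  filter_from [set: nat] (fun n => [set xy | cyl n xy.1 xy.2]).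

Lemma bits_ent_filter : Filter bits_ent.
Proof.
apply: filter_from_filter; first by exists 0%N.
move=> i j _ _; exists (maxn i j) => // xy xyij.
by split; apply: cyl_le xyij; [exact: leq_maxl|exact: leq_maxr].
Qed.

Lemma bits_ent_diagonal A : bits_ent A -> diagonal `<=` A.
Proof. by move=> [n _ nA] [x y] xy; apply: nA => /=; rewrite (xy : x = y). Qed.

Lemma bits_ent_inv A : bits_ent A -> bits_ent A^-1.
Proof.
by move=> [n _ nA]; exists n => // -[x y] /= xy; apply: nA; exact: cyl_sym.
Qed.

Lemma bits_ent_split A : bits_ent A -> exists2 B, bits_ent B & B \; B `<=` A.
Proof.
move=> [n _ nA]; exists [set xy | cyl n xy.1 xy.2]; first by exists n.
by move=> [x y] [z /= xz zy]; apply: nA; exact: cyl_trans xz zy.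
Qed.

HB.instance Definition _ := isUniform.Build bits
  bits_ent_filter bits_ent_diagonal bits_ent_inv bits_ent_split.
End BitsUniform.

Lemma bits_nbhsP (x : bits) (A : set bits) :
  nbhs x A <-> exists n, cyl n x `<=` A.
Proof.
rewrite -nbhs_entourageE; split.
  move=> [B [n _ nB] BA]; exists n => y xy.
  by apply: BA; apply/xsectionP; exact: nB.
move=> [n nA]; exists [set xy | cyl n xy.1 xy.2]; first by exists n.
by move=> y /xsectionP; exact: nA.
Qed.

Lemma bits_cauchy_cvg (F : set_system bits) :
  ProperFilter F -> cauchy F -> [cvg F in bits].
Proof.
move=> FF cF; have Fn n : exists x, F (cyl n x).
  have /cF : entourage [set xy : bits * bits | cyl n xy.1 xy.2] by exists n.
  move=> [[A B] /= [FA FB] AB]; have [x Ax] := filter_ex FA.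
  by exists x; apply: filterS FB => y By; exact: (AB (x, y)).
(* A cylinder of length [k.+1] belonging to the filter fixes the coordinate [k] of the limit. *)
pose z : bits := fun k => projT1 (cid (Fn k.+1)) k.
apply/cvg_ex; exists z => A /bits_nbhsP[n nA].
rewrite /nbhs /=; have Fk k : F [set y | z k = y k].
  by rewrite /z; case: cid => x /= Fx; apply: filterS Fx => y; exact.
suff : F (cyl n z) by apply: filterS.
elim: n {nA} => [|n IHn]; first by apply: filterS filterT => y _ [].
apply: filterS2 IHn (Fk n) => y zy zn k.
by rewrite ltnS leq_eqVlt => /predU1P[->|/zy].
Qed.

HB.instance Definition _ := Uniform_isComplete.Build bits bits_cauchy_cvg.

Section BitsMetric.
Variable R : realType.

(** The open ball for the distance [1/(k+1)], where [k] is the first coordinate at which the points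
    differ. Without [0 < e] the triangle inequality would fail for negative radii. *)
Definition bits_ball (x : bits) (e : R) (y : bits) : Prop :=
  0 < e /\ forall k, e <= k.+1%:R^-1 -> x k = y k.

Lemma bits_ball_center x (e : R) : 0 < e -> bits_ball x e x.
Proof. by []. Qed.

Lemma bits_ball_sym x y (e : R) : bits_ball x e y -> bits_ball y e x.
Proof. by move=> [e0 xy]; split=> // k /xy. Qed.

Lemma bits_ball_triangle x y z (e1 e2 : R) :
  bits_ball x e1 y -> bits_ball y e2 z -> bits_ball x (e1 + e2) z.
Proof.
move=> [e10 xy] [e20 yz]; split=> [|k ek]; first exact: addr_gt0.
rewrite xy ?yz//; first by rewrite (le_trans _ ek)// lerDr ltW.
by rewrite (le_trans _ ek)// lerDl ltW.
Qed.

Lemma bits_entourageE : entourage = entourage_ bits_ball.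
Proof.
apply/seteqP; split=> A.
  move=> [n _ nA]; exists (n.+1%:R^-1) => /=; first by rewrite invr_gt0 ltr0n.
  move=> [x y] [_ xy]; apply: nA => k kn; apply: xy.
  by rewrite lef_pV2 ?posrE ?ltr0n// ler_nat; exact: leqW.
move=> [e /= e0 eA]; exists (Num.truncn e^-1).+1 => // -[x y] /= xy.
apply: eA; split=> //= k ek; apply: xy; rewrite ltnS.
have : (k.+1%:R : R) <= e^-1.
  by rewrite -[leLHS]invrK lef_pV2// posrE ?invr_gt0 ?ltr0n.
by move=> /le_lt_trans/(_ (truncnS_gt _)); rewrite ltr_nat ltnS => /ltnW.
Qed.

HB.instance Definition _ := Uniform_isPseudoMetric.Build R bits
  bits_ball_center bits_ball_sym bits_ball_triangle bits_entourageE.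
End BitsMetric.

HB.instance Definition _ := @isMeasurable.Build (sigma_display (@open bits)) bits
  <<s @open bits >> (@sigma_algebra0 _ setT (@open bits))
  (@sigma_algebraC _ (@open bits)) (@sigma_algebra_bigcup _ setT (@open bits)).

Lemma standard_borel_bits (R : realType) : standard_borel R bits.
Proof.
exists bits; split.
- move=> x y xy; apply: contrapT => nxy.
  have [k xyk] : exists k, x k <> y k.
    apply: contrapT => nk; apply: nxy; apply/funext => k.
    by apply: contrapT => nxyk; apply: nk; exists k.
  have [||z [zx zy]] := xy (cyl k.+1 x) (cyl k.+1 y).
  - by apply/bits_nbhsP; exists k.+1.
  - by apply/bits_nbhsP; exists k.+1.
  - by apply: xyk; rewrite zx// zy.
- exists (range (fun s : seq bool => nth false s : bits)).
    exact: sub_countable (card_image_le _ _) (countableP _).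
  move=> A [x Ax] oA.
  have /bits_nbhsP[n nA] : nbhs x A by exact: open_nbhs_nbhs.
  exists (nth false (mkseq x n)); split; last by exists (mkseq x n).
  by apply: nA => k kn; rewrite nth_mkseq.
- by exists id => //; exists id.
Qed.

Lemma open_cyl n x : open (cyl n x).
Proof.
by rewrite openE => y xy; apply/bits_nbhsP; exists n; rewrite (cyl_eq xy).
Qed.

Lemma measurable_cyl n x : measurable (cyl n x).
Proof. by apply: sub_sigma_algebra; exact: open_cyl. Qed.

(** Two cylinders are nested or disjoint, so adding the empty set gives a family closed under
    intersection, as uniqueness of measures requires. *)
Definition cyls : set (set bits) :=
  [set A | A = set0 \/ exists n x, A = cyl n x].

(** An open set is the union of the cylinders it contains, and cylinders are coded by finite words,
    hence countable in number. *)
Lemma measurable_bitsE : @measurable _ bits = <<s cyls >>.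
Proof.
apply/seteqP; split; last first.
  apply: smallest_sub; first exact: sigma_algebra_measurable.
  by move=> _ [->|[n [x ->]]]; [exact: measurable0|exact: measurable_cyl].
apply: smallest_sub => [|A oA]; first exact: smallest_sigma_algebra.
pose T := g_sigma_algebraType cyls.
suff -> : A =
    \bigcup_(s in [set s : seq bool | cyl (size s) (nth false s) `<=` A])
      cyl (size s) (nth false s).
  rewrite bigcup_mkcond; apply: (@countable_bigcupT_measurable _ T) => // s.
  case: ifPn => // _; apply: sub_sigma_algebra.
  by right; exists (size s), (nth false s).
apply/seteqP; split=> [x Ax|x [s /= sA] /sA//].
have /bits_nbhsP[n nA] : nbhs x A by exact: open_nbhs_nbhs.
have xs : cyl n x (nth false (mkseq x n)) by move=> k kn; rewrite nth_mkseq.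
exists (mkseq x n); rewrite /= size_mkseq -(cyl_eq xs)//.
Qed.

Lemma cyls_setI : setI_closed cyls.
Proof.
move=> _ _ [->|[n [x ->]]] [->|[m [y ->]]]; rewrite ?set0I ?setI0; try by left.
have [->|/set0P[z [xz yz]]] := eqVneq (cyl n x `&` cyl m y) set0; first by left.
right; exists (maxn n m), z; rewrite (cyl_eq xz) (cyl_eq yz).
apply/seteqP; split=> [w [nzw mzw] k|w zw].
  by rewrite leq_max => /orP[/nzw|/mzw].
by split; apply: cyl_le zw; [exact: leq_maxl|exact: leq_maxr].
Qed.

Lemma bits_measurable_fun d (T : measurableType d) (f : T -> bits) :
  (forall n x, measurable (f @^-1` cyl n x)) -> measurable_fun setT f.
Proof.
move=> mf; apply: (@measurability _ _ T bits setT f cyls measurable_bitsE).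
move=> _ [A [->|[n [x ->]]] <-]; rewrite setTI; last exact: mf.
by rewrite preimage_set0.
Qed.

Lemma bits_measure_unique (R : realType) (p q : {measure set bits -> \bar R}) :
  (p setT < +oo)%E -> (forall n x, p (cyl n x) = q (cyl n x)) ->
  forall A, measurable A -> p A = q A.
Proof.
move=> poo pq A mA; apply: (measure_unique cyls (fun=> setT)) => //.
- exact: measurable_bitsE.
- exact: cyls_setI.
- move=> _; right; exists 0%N, point.
  by apply/seteqP; split=> // y _ k.
- by rewrite bigcup_const//; exists 0%N.
- by move=> _ [->|[n [x ->]]]//; rewrite !measure0.
Qed.

Definition flip (n : nat) (x : bits) : bits :=
  fun k => if k == n then ~~ x k else x k.

Lemma flip_cyl n k x : flip k @^-1` cyl n x = cyl n (flip k x).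
Proof.
apply/seteqP; split=> y /= xy i /xy; rewrite /flip; case: eqP => // _.
  by move=> ->; rewrite negbK.
by move=> <-; rewrite negbK.
Qed.

Lemma measurable_flip n : measurable_fun setT (flip n).
Proof.
by apply: bits_measurable_fun => m x; rewrite flip_cyl; exact: measurable_cyl.
Qed.

Section FairCoins.
Variable R : realType.

(** Flipping the coordinate [n] exchanges the two halves of [cyl n x]. *)
Lemma flip_invariant_cyl (p : {measure set bits -> \bar R}) :
  p setT = 1%E -> (forall n A, measurable A -> p (flip n @^-1` A) = p A) ->
  forall n x, p (cyl n x) = (2^-1 ^+ n)%:E.
Proof.
move=> p1 pflip; elim=> [|n IHn] x.
  by rewrite expr0 -p1; congr (p _); apply/seteqP; split=> // y _ k.
have : p (cyl n x) = (p (cyl n.+1 x) + p (cyl n.+1 (flip n x)))%E.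
  rewrite -measureU; [|exact: measurable_cyl|exact: measurable_cyl|].
    congr (p _); apply/seteqP; split=> [y xy|y [xy|xy]].
    - have [xyn|xyn] := eqVneq (x n) (y n); [left|right] => k;
        rewrite ltnS leq_eqVlt.
        by move=> /predU1P[->//|/xy].
      rewrite /flip; case: eqVneq => /= [->|kn]; last exact: xy.
      by case: (x n) (y n) xyn => [] [].
    - exact: cyl_le xy.
    - by move=> k kn; have := xy k (ltnW kn); rewrite /flip ltn_eqF.
  apply/seteqP; split=> // y [xy xfy]; have := xfy n (leqnn _).
  by rewrite -(xy n)// /flip eqxx; case: (x n).
rewrite -flip_cyl pflip; last exact: measurable_cyl.
rewrite IHn; case: (p _) => [r|//|//]; rewrite -EFinD => -[rr]; congr (_%:E).
by rewrite exprS rr; lra.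
Qed.

End FairCoins.

(** * The fair coin measure as the law of binary digits *)

Section FairMeasure.
Variable R : realType.

(** The binary expansion of [u] in [[0, 1[]: the parity of [floor(2^(k+1) u)] is the digit of weight
    [2^-(k+1)]. Elsewhere all digits are [false], which keeps the total function measurable. *)
Definition digits (u : R) : bits :=
  fun k => (0 <= u < 1) && odd (Num.truncn (2 ^+ k.+1 * u)).

(** The integer written in base two by the first [n] coordinates, most significant first. *)
Definition prefix_value (x : bits) (n : nat) : nat :=
  iteri n (fun k j => x k + j.*2)%N 0%N.

Lemma prefix_value_lt x n : (prefix_value x n < 2 ^ n)%N.
Proof.
elim: n => //= n IHn; rewrite expnS mul2n.
by case: (x n) => /=; lia.
Qed.

(** The half of [floor(2v)] is [floor(v)], so doubling appends one binary digit; this is the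
    inductive step for reading prefixes. *)
Lemma truncn_double (v : R) : 0 <= v ->
  Num.truncn (2 * v) = (odd (Num.truncn (2 * v)) + (Num.truncn v).*2)%N.
Proof.
move=> v0; have v20 : 0 <= 2 * v by rewrite mulr_ge0.
have /andP[a b] := truncn_itv v0; have /andP[c d] := truncn_itv v20.
move: (Num.truncn v) (Num.truncn (2 * v)) a b c d => s t a b c d.
rewrite -[LHS]odd_double_half; congr (_ + _.*2)%N.
apply/eqP; rewrite eqn_leq; apply/andP; split.
  rewrite -ltnS ltn_half_double -(ltr_nat R) (le_lt_trans c)//.
  rewrite -muln2 natrM mulrC.
  by rewrite ltr_pM2r.
rewrite geq_half_double -ltnS -(ltr_nat R) (le_lt_trans _ d)//.
rewrite -muln2 natrM mulrC.
by rewrite ler_pM2l.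
Qed.

Lemma digits_cyl (u : R) n x : 0 <= u < 1 ->
  cyl n x (digits u) <-> Num.truncn (2 ^+ n * u) = prefix_value x n.
Proof.
move=> u01; have /andP[u0 u1] := u01.
elim: n => [|n [IH IH']].
  by rewrite expr0 mul1r; split=> // _; apply: truncn_def; rewrite u0.
have cylS : cyl n.+1 x (digits u) <-> cyl n x (digits u) /\ x n = digits u n.
  split=> [xu|[xu xn] k].
    by split; [apply: cyl_le xu|exact: xu].
  by rewrite ltnS leq_eqVlt => /predU1P[->|/xu].
have dn : digits u n = odd (Num.truncn (2 ^+ n.+1 * u)) by rewrite /digits u01.
have v0 : 0 <= 2 ^+ n * u by rewrite mulr_ge0 ?exprn_ge0.
have T := truncn_double v0.
rewrite mulrA -exprS -dn in T; rewrite cylS T /=; split=> [[xu ->]|e].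
  by rewrite (IH xu).
have : odd (digits u n + (Num.truncn (2 ^+ n * u)).*2) =
  odd (x n + (prefix_value x n).*2) by rewrite e.
rewrite !oddD !odd_double !addbF !oddb => ox; split=> //; apply: IH'.
by move: e; rewrite ox => /addnI /double_inj.
Qed.

(** This dyadic interval serves twice: for the measurability of [digits], and for the mass [2^-n] of
    a cylinder. *)
Lemma digits_cyl_itv n x : digits @^-1` cyl n x `&` `[0, 1[%classic =
  `[2 ^- n * (prefix_value x n)%:R,
    2 ^- n * (prefix_value x n).+1%:R[%classic.
Proof.
have p0 : 0 < (2 ^+ n : R) by rewrite exprn_gt0.
have xlt : ((prefix_value x n).+1%:R : R) <= 2 ^+ n.
  by rewrite -natrX ler_nat; exact: prefix_value_lt.
have mem (u : R) : (2 ^- n * (prefix_value x n)%:R <= u <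
      2 ^- n * (prefix_value x n).+1%:R) =
    ((prefix_value x n)%:R <= 2 ^+ n * u < (prefix_value x n).+1%:R).
  by rewrite -(ler_pM2l p0) -(ltr_pM2l p0 u) !mulrA mulfV ?mul1r// gt_eqF.
apply/seteqP; split=> u /=; rewrite !in_itv /=.
  move=> [/digits_cyl du u01]; rewrite mem -truncn_eq ?mulr_ge0// ?(ltW p0)//.
    by apply/eqP; exact: du.
  by have /andP[] := u01.
move=> uI; have u01 : 0 <= u < 1.
  have /andP[a b] := uI; apply/andP; split.
    by apply: le_trans a; rewrite mulr_ge0// invr_ge0 ltW.
  by apply: lt_le_trans b _; rewrite ler_pdivrMl// mulr1.
split=> //; apply/digits_cyl => //; apply/eqP; have /andP[u0 _] := u01.
by rewrite truncn_eq -?mem// mulr_ge0// ltW.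
Qed.

Lemma measurable_digits : measurable_fun setT digits.
Proof.
apply: bits_measurable_fun => n x.
pose D : set R := `[0, 1[%classic.
have mD : measurable D by exact: measurable_itv.
rewrite -(setIT (_ @^-1` _)) -(setUv D) setIUr; apply: measurableU.
  by rewrite digits_cyl_itv; exact: measurable_itv.
have dD u : (~` D) u -> digits u = fun=> false.
  by rewrite /D /= in_itv /= /digits => /negP/negbTE ->.
have [x0|nx0] := pselect (cyl n x (fun=> false)).
  rewrite setIidr; first exact: measurableC.
  by move=> u /dD; rewrite /preimage /= => ->.
rewrite (_ : _ `&` _ = set0)//; apply/seteqP; split=> // u [/= xu /dD du].
by rewrite du in xu.
Qed.

Let m01 : measurable (`[0, 1[%classic : set R).
Proof. exact: measurable_itv. Qed.

(** Taking the digits of a uniform point gives independent fair coins directly from Lebesgue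
    measure, with no infinite product to construct. *)
Definition fair : set bits -> \bar R :=
  pushforward (mrestr lebesgue_measure m01) digits.

HB.instance Definition _ := Measure.copy fair
  (measure_function_pushforward__canonical__measure_function_Measure
     (mrestr lebesgue_measure m01) measurable_digits).

Lemma fair_cyl n x : fair (cyl n x) = (2^-1 ^+ n)%:E.
Proof.
rewrite /fair /pushforward /mrestr digits_cyl_itv lebesgue_measure_itv /=.
rewrite lte_fin.
rewrite ltr_pM2l ?invr_gt0 ?exprn_gt0// ltr_nat leqnn -EFinB -mulrBr.
by rewrite -natrB// subSnn mulr1 exprVn.
Qed.

Lemma fair_setT : fair setT = 1%E.
Proof.
have := fair_cyl 0 point; rewrite expr0 => <-.
by congr (fair _); apply/seteqP; split=> // y _ k.
Qed.

HB.instance Definition _ := Measure_isProbability.Build _ _ _ fair fair_setT.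

Lemma fair_flip n A : measurable A -> fair (flip n @^-1` A) = fair A.
Proof.
apply: (bits_measure_unique
  (p := measure_function_pushforward__canonical__measure_function_Measure
     fair (measurable_flip n)) (q := fair)).
  by rewrite /= /pushforward preimage_setT fair_setT ltry.
by move=> k x; rewrite /= /pushforward flip_cyl !fair_cyl.
Qed.

End FairMeasure.

(** * Coordinate permutations and freeness of the shift *)

Section Bernoulli.
Variable R : realType.
Local Notation fair := (fair R).

Lemma measurable_coord i b : measurable [set x : bits | x i = b].
Proof.
apply: sub_sigma_algebra; rewrite openE => x /= xi; apply/bits_nbhsP.
by exists i.+1 => y xy; rewrite /= -(xy i).
Qed.

Lemma measurable_coord_eq i j : measurable [set x : bits | x i = x j].
Proof.
rewrite (_ : mkset _ = ([set x : bits | x i = true] `&` [set x | x j = true]) `|`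
   ([set x : bits | x i = false] `&` [set x | x j = false])).
  by apply: measurableU; apply: measurableI; exact: measurable_coord.
apply/seteqP; split=> x /=; first by case: (x i) => <-; [left|right].
by case=> [[-> ->]|[-> ->]].
Qed.

(** Permuting the coordinates intertwines the flips, and the flip-invariant
    probability measure is unique. *)
Lemma fair_perm (t t' : nat -> nat) : cancel t t' -> cancel t' t ->
  preserves fair (fun x : bits => x \o t : bits).
Proof.
move=> tK t'K; pose P : bits -> bits := fun x => x \o t.
change (preserves fair P).
have mP : measurable_fun setT P.
  apply: bits_measurable_fun => n x.
  rewrite (_ : _ @^-1` _ =
      \bigcap_(k in `I_n) [set y : bits | y (t k) = x k]).
    by apply: bigcap_measurableType => k _; exact: measurable_coord.
  by apply/seteqP; split=> y xy k kn; exact/esym/(xy k kn).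
split=> //; apply: (bits_measure_unique
  (p := measure_function_pushforward__canonical__measure_function_Measure fair mP)
  (q := fair)).
  by rewrite /= /pushforward preimage_setT fair_setT ltry.
move=> n x; apply: etrans (esym (fair_cyl R n x)); apply: flip_invariant_cyl.
  by rewrite /= /pushforward preimage_setT fair_setT.
move=> k A mA; rewrite /= /pushforward -comp_preimage.
rewrite (_ : flip k \o P = P \o flip (t k)); last first.
  apply/funext => y; apply/funext => i; rewrite /P /flip /=.
  by rewrite (inj_eq (can_inj tK)).
rewrite comp_preimage fair_flip//.
by have := mP measurableT A mA; rewrite setTI.
Qed.

(** Flipping [x (i n)] exchanges agreement and disagreement with [x (j n)]. *)
Lemma fair_coincidences (i j : nat -> nat) :
  injective i -> (forall m n, i m <> j n) ->
  forall n, fair [set x : bits | forall k, (k < n)%N -> x (i k) = x (j k)] =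
    (2^-1 ^+ n)%:E.
Proof.
move=> iI ij.
pose A n := [set x : bits | forall k, (k < n)%N -> x (i k) = x (j k)].
have mA n : measurable (A n).
  rewrite (_ : A n = \bigcap_(k in `I_n) [set y : bits | y (i k) = y (j k)])//.
  by apply: bigcap_measurableType => k _; exact: measurable_coord_eq.
have AS n : A n.+1 = A n `&` [set x | x (i n) = x (j n)].
  apply/seteqP; split=> [x Ax|x [Ax xn] k].
    by split=> [k kn|]; apply: Ax => //; exact: ltnW.
  by rewrite ltnS leq_eqVlt => /predU1P[->|/Ax].
elim=> [|n].
  by rewrite expr0 -(fair_setT R); congr (fair _); apply/seteqP; split.
rewrite -/(A n) -/(A n.+1) => IHn.
have : fair (A n) = (fair (A n.+1) + fair (flip (i n) @^-1` A n.+1))%E.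
  rewrite -measureU//.
  - congr (fair _); rewrite AS; apply/seteqP; split=> x.
      move=> Ax; have [xn|xn] := eqVneq (x (i n)) (x (j n)); [by left|right].
      split=> [k kn|] /=; rewrite /flip ?eqxx.
        rewrite (inj_eq iI) (ltn_eqF kn).
        by case: eqP => [/esym/ij//|_]; exact: Ax.
      by case: eqP => [/esym/ij//|_]; case: (x _) (x _) xn => [] [].
    case=> [[]//|[Ax _]] k kn; have := Ax k kn.
    rewrite /flip (inj_eq iI) (ltn_eqF kn).
    by case: eqP => [/esym/ij//|_].
  - by have := measurable_flip (i n) measurableT (mA n.+1); rewrite setTI.
  - apply/seteqP; split=> // x [Ax fAx].
    have xn := Ax n (leqnn _); have := fAx n (leqnn _).
    rewrite /flip eqxx; case: eqP => [/esym/ij//|_].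
    by rewrite xn; case: (x _).
rewrite fair_flip// IHn; case: (fair _) => [r|//|//]; rewrite -EFinD => -[rr].
by congr (_%:E); rewrite exprS rr; lra.
Qed.

Lemma fair_coincidences_null (i j : nat -> nat) :
  injective i -> (forall m n, i m <> j n) ->
  fair.-negligible [set x : bits | forall k, x (i k) = x (j k)].
Proof.
move=> iI ij; set B := mkset _.
have mB : measurable B.
  rewrite (_ : B = \bigcap_(k in setT) [set y : bits | y (i k) = y (j k)]).
    by apply: bigcap_measurableType => k _; exact: measurable_coord_eq.
  by apply/seteqP; split=> [x Bx k _|x Bx k]; exact: Bx.
exists B; split=> //; apply/eqP; rewrite eq_le measure_ge0 andbT.
apply/lee_addgt0Pr => e e0; rewrite add0e.
(* With this [n], [1/e < n + 1 <= 2^n], so [n] coincidences already have probability below [e]. *)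
pose n := Num.truncn e^-1.
apply: (@le_trans _ _
  (fair [set x : bits | forall k, (k < n)%N -> x (i k) = x (j k)])).
  apply: le_measure; rewrite ?inE//; last by move=> x Bx k _; exact: Bx.
  rewrite (_ : mkset _ = \bigcap_(k in `I_n) [set y : bits | y (i k) = y (j k)])//.
  by apply: bigcap_measurableType => k _; exact: measurable_coord_eq.
rewrite fair_coincidences// lee_fin exprVn -[leRHS]invrK.
rewrite lef_pV2 ?posrE ?invr_gt0 ?exprn_gt0//.
apply: ltW; apply: lt_le_trans (truncnS_gt _) _.
by rewrite -natrX ler_nat; exact: ltn_expl.
Qed.

(** The coins are indexed by [G * nat], coded in [nat] by [e], so that there are infinitely many per
    element even for finite [G]. A point fixed by [g <> 1] has the same coins at [(1, k)] and
    [(g^-1, k)] for every [k], an event of probability zero. *)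
Lemma bernoulli_action (G : groupType) : countable [set: G] ->
  exists (d : measure_display) (Z : measurableType d) (mu : probability Z R)
    (a : G -> Z -> Z),
    [/\ standard_borel R Z, is_action a, forall g, preserves mu (a g) &
        essentially_free mu a].
Proof.
move=> cG; have [e [e' eK e'K]] : exists e : G * nat -> nat, bijective e.
  have : ([set: G * nat] #= [set: nat])%card.
    apply: eq_card_nat; first by rewrite -setXTT; exact: countableX.
    move=> fGn; apply: infinite_nat; rewrite (_ : setT = snd @` [set: G * nat]).
      exact: finite_image.
    by apply/seteqP; split=> // n _; exists (1%g, n).
  by move=> /card_set_bijP[e]; rewrite setTT_bijective => eB; exists e.
(* Translation by [g^-1] makes [t] reverse products; precomposition reverses them again and gives a
   left action. *)
pose t g i := e ((g^-1 * (e' i).1)%g, (e' i).2).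
have t1 i : t 1%g i = i by rewrite /t invg1 mul1g -surjective_pairing e'K.
have tM g h i : t (g * h)%g i = t h (t g i).
  by rewrite /t eK /= invgM mulgA.
have tK g : cancel (t g) (t g^-1%g) by move=> i; rewrite -tM mulgV t1.
have tK' g : cancel (t g^-1%g) (t g) by move=> i; rewrite -tM mulVg t1.
exists _, bits, fair, (fun g (x : bits) => x \o t g : bits); split.
- exact: standard_borel_bits.
- split=> [x|g h x]; apply/funext => i /=; first by rewrite t1.
  by rewrite tM.
- by move=> g; exact: fair_perm (tK g) (tK' g).
have [code [decode codeK]] := countable_code 1%g cG.
have : fair.-negligible (\bigcup_n
    [set x : bits | decode n <> 1%g /\ x \o t (decode n) = x]).
  apply: negligible_bigcup => n; have [->|g1] := eqVneq (decode n) 1%g.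
    rewrite (_ : mkset _ = set0); first exact: negligible_set0.
    by apply/seteqP; split=> x [].
  apply: negligibleS (fair_coincidences_null (i := fun k => e (1%g, k))
    (j := fun k => e ((decode n)^-1%g, k)) _ _).
  - move=> x [_ /= tx] k; rewrite -[in LHS]tx /= /t eK /=.
    by rewrite mulg1.
  - by move=> k l /(can_inj eK) [].
  - by move=> k l /(can_inj eK) [] /esym/eqP; rewrite invg_eq1 (negbTE g1).
apply: negligibleS => x /= nf; apply: contrapT => nU; apply: nf => g gx.
by apply: contrapT => g1; apply: nU; exists (code g) => //=; rewrite codeK.
Qed.

End Bernoulli.

(** * Graph products of actions *)

Section VertexAction.
Variables (V : finType) (E : rel V) (Eirr : irreflexive E).
Variables (Gv : V -> groupType) (G : groupType) (i : forall v, Gv v -> G).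
Arguments i : clear implicits.
Hypothesis pG : presentation E i.

(** An element of [Gv v] can be fed to [b] only after transport along a proof of [v = w]; on an
    [eqType] such proofs are unique, so the transport is trivial when [v] is [w]. *)
Definition vertex_act (Y : Type) (w : V) (b : Gv w -> Y -> Y) (v : V) :
    Gv v -> Y -> Y :=
  if @eqP _ v w is ReflectT e then fun g => b (eq_rect v Gv g w e)
  else fun=> id.

Lemma vertex_actE Y w (b : Gv w -> Y -> Y) : vertex_act b (v := w) = b.
Proof.
by rewrite /vertex_act; case: eqP => // e; rewrite (eq_axiomK e).
Qed.

Lemma vertex_actN Y w (b : Gv w -> Y -> Y) v g y :
  v != w -> vertex_act b (v := v) g y = y.
Proof. by rewrite /vertex_act; case: eqP. Qed.

(** The action of [Gv w] extended to [G] through the retraction that kills the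
    other vertex groups. *)
Lemma vertex_extension (Y : Type) (w : V) (b : Gv w -> Y -> Y) :
  is_action b -> exists c : G -> Y -> Y,
    [/\ is_action c, forall g y, c (i w g) y = b g y &
        forall v g y, v != w -> c (i v g) y = y].
Proof.
move=> bA; have [||c cA cE] := pres_act pG (b := @vertex_act Y w b).
- move=> v; have [->|vw] := eqVneq v w; first by rewrite vertex_actE.
  by split=> *; rewrite !vertex_actN.
(* Adjacent vertices are distinct, so at least one of the two acts as the identity. *)
- move=> v u g h y vu; have [vw|vw] := eqVneq v w.
    have uw : u != w by apply: contraTneq vu => ->; rewrite vw Eirr.
    by rewrite !(vertex_actN b (v := u)).
  by rewrite !(vertex_actN b (v := v)).
exists c; split=> // [g y|v g y vw]; first by rewrite cE vertex_actE.
by rewrite cE vertex_actN.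
Qed.

End VertexAction.

Section CombinedAction.
Variable R : realType.
Variables (V : finType) (E : rel V) (Eirr : irreflexive E).
Variables (Gv Hv : V -> groupType) (G : groupType) (i : forall v, Gv v -> G).
Arguments i : clear implicits.
Hypothesis pG : presentation E i.

(** The first two clauses hold at every point, as [cocycle_extension] demands; only bijectivity is
    almost sure. *)
Definition vertex_cocycle d (X : measurableType d)
    (mu : {measure set X -> \bar R}) (a : G -> X -> X) (v : V)
    (C : Hv v -> X -> Gv v) : Prop :=
  [/\ cocycle (fun g => a (i v g)) C,
      forall w h g x, w != v -> C h (a (i w g) x) = C h x,
      forall h g, measurable (C h @^-1` [set g]) &
      {ae mu, forall x, bijective (C ^~ x)}].

(** The second measure is only sigma-finite because the lemma is also applied to the counting
    measure on [G]. *)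
Lemma negligible_fst d (X : measurableType d) d' (Y : measurableType d')
    (mu : {measure set X -> \bar R})
    (nu : {sigma_finite_measure set Y -> \bar R})
    (A : set X) :
  mu.-negligible A -> (mu \x nu)%E.-negligible (fst @^-1` A).
Proof.
move=> [N [mN N0 AN]]; exists (N `*` setT); split.
- exact: measurableX.
- by apply: etrans (product_measure1E _ _ mN measurableT) _;
  rewrite [X in (X * _)%E]N0 mul0e.
- by move=> [x y] /= /AN.
Qed.

Lemma negligible_snd d (X : measurableType d) d' (Y : measurableType d')
    (mu : probability X R) (nu : probability Y R) (A : set Y) :
  nu.-negligible A -> (mu \x nu)%E.-negligible (snd @^-1` A).
Proof.
move=> [N [mN N0 AN]]; exists (setT `*` N); split.
- exact: measurableX.
- by apply: etrans (product_measure1E _ _ measurableT mN) _;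
  rewrite [X in (_ * X)%E]N0 mule0.
- by move=> [x y] /= /AN.
Qed.

(** The factors are added one vertex at a time, starting from the Bernoulli shift. A diagonal action
    is free as soon as one factor is, and the cocycles pull back along the projections: the new one
    ignores the other vertex groups because they act trivially on [Y], the old ones because they do
    not see [Y]. *)
Lemma combined_action_seq (s : seq V) :
  (forall v, countable [set: Gv v]) ->
  (forall v, admit_orbit_equivalent_free_actions R (Gv v) (Hv v)) ->
  exists (d : measure_display) (X : measurableType d) (mu : probability X R)
    (a : G -> X -> X),
    [/\ standard_borel R X, is_action a, forall g, preserves mu (a g),
        essentially_free mu a &
        forall v, v \in s -> exists C, vertex_cocycle mu a (v := v) C].
Proof.
move=> cG hGH; elim: s => [|w s [d [X [mu [a [sX aA aP aF aC]]]]]].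
  have [d [Z [mu [a [sZ aA aP aF]]]]] :=
    bernoulli_action R (presentation_countable pG cG).
  by exists d, Z, mu, a; split.
have [d' [Y [nu [b [D [sY [bA bP] Dc mD Dbij]]]]]] :=
  orbit_cocycle (cG w) (hGH w).
have [c [cA cE cN]] := vertex_extension Eirr pG bA.
have cP g : preserves nu (c g).
  elim/(pres_ind pG): g => [|v g k IH].
    rewrite (_ : c 1%g = id); first exact: preserves_id.
    by apply/funext => y; rewrite cA.1.
  rewrite (_ : c _ = c (i v g) \o c k); last by apply/funext => y; rewrite cA.2.
  apply: preserves_comp IH.
  have [vw|vw] := eqVneq v w.
    subst v; rewrite (_ : c _ = b g)//.
    by apply/funext => y; rewrite cE.
  rewrite (_ : c _ = id); first exact: preserves_id.
  by apply/funext => y; rewrite cN.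
exists _, (X * Y)%type, (mu \x nu)%E, (fun g z => (a g z.1, c g z.2)); split.
- exact: standard_borel_prod.
- by split=> [[x y]|g h [x y]] /=; rewrite ?aA.1 ?cA.1 ?aA.2 ?cA.2.
- by move=> g; exact: preserves_prod (aP g) (cP g).
- apply: negligibleS (negligible_fst nu aF) => z /= nz fz; apply: nz => g gz.
  by apply: fz; rewrite -[in RHS]gz.
move=> v; rewrite in_cons; have [-> _|_ /= /aC] := eqVneq v w.
  exists (fun h z => D h z.2); split=> [|v' h g z vw||].
  - split=> [z|h k z] /=; first by rewrite Dc.1.
    by rewrite Dc.2 cE.
  - by rewrite /= cN.
  - move=> h g; rewrite -[X in measurable X]setTI.
    exact: (@measurable_snd _ _ X Y measurableT _ (mD h g)).
  - by apply: negligibleS (negligible_snd mu Dbij) => z /=.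
move=> [C [Cc Cinv mC Cbij]]; exists (fun h z => C h z.1); split.
- by split=> [z|h k z] /=; [rewrite Cc.1|rewrite Cc.2].
- by move=> v' h g z vv /=; rewrite Cinv.
- move=> h g; rewrite -[X in measurable X]setTI.
  exact: (@measurable_fst _ _ X Y measurableT _ (mC h g)).
- by apply: negligibleS (negligible_fst nu Cbij) => z /=.
Qed.

End CombinedAction.

Lemma negligible_preimage (R : realType) d (T : measurableType d)
    (mu : {measure set T -> \bar R}) (f : T -> T) (A : set T) :
  preserves mu f -> mu.-negligible A -> mu.-negligible (f @^-1` A).
Proof.
move=> [mf fm] [N [mN N0 AN]]; exists (f @^-1` N); split.
- by have := mf measurableT N mN; rewrite setTI.
- by rewrite fm.
- by move=> x /AN.
Qed.

Lemma preserves_mp_action (R : realType) d (X : measurableType d)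
    (mu : {measure set X -> \bar R}) (G : groupType) (a : G -> X -> X) :
  is_action a -> (forall g, preserves mu (a g)) -> mp_action mu a.
Proof.
move=> aA aP; split=> [//|g|g A mA]; first exact: (aP g).1.
exact: (aP g).2.
Qed.

Definition bijective_cocycle (R : realType) d (X : measurableType d)
    (mu : {measure set X -> \bar R}) (G H : groupType) (a : G -> X -> X)
    (c : H -> X -> G) : Prop :=
  [/\ is_action a, forall g, preserves mu (a g), essentially_free mu a,
      cocycle a c & (forall h g, measurable (c h @^-1` [set g])) /\
      {ae mu, forall x, bijective (c ^~ x)}].

(** The vertex cocycles may fail to be bijective on a null set, so [cocycle_extension_bij] is not
    applied on [X]. The translates of that set by the countable group [G] are still null together;
    for [x] outside them, the orbit of [x] is a space on which all its hypotheses hold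
    everywhere. *)
Lemma graph_product_bijective_cocycle (R : realType) (V : finType) (E : rel V)
    (Gv Hv : V -> groupType) (G H : groupType)
    (iG : forall v, Gv v -> G) (iH : forall v, Hv v -> H) :
  irreflexive E -> presentation E iG -> presentation E iH ->
  (forall v, countable [set: Gv v]) ->
  (forall v, admit_orbit_equivalent_free_actions R (Gv v) (Hv v)) ->
  exists (d : measure_display) (X : measurableType d) (mu : probability X R)
    (a : G -> X -> X) (c : H -> X -> G),
    standard_borel R X /\ bijective_cocycle mu a c.
Proof.
move=> Eirr pG pH cGv hGH; have cG := presentation_countable pG cGv.
have [d [X [mu [a [sX aA aP aF aC]]]]] :=
  combined_action_seq Eirr pG (enum V) cGv hGH.
have vC v : exists C : Hv v -> X -> Gv v, vertex_cocycle iG mu a (v := v) C.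
  by apply: aC; rewrite mem_enum.
pose C v := projT1 (cid (vC v)).
have CP v : vertex_cocycle iG mu a (C v) by rewrite /C; case: cid.
have Cc v : cocycle (fun g => a (iG v g)) (C v) by have [] := CP v.
have Cinv v w h g x : w != v -> C v h (a (iG w g) x) = C v h x.
  by have [_ + _ _] := CP v; apply.
have mC v h g : measurable (C v h @^-1` [set g]) by have [] := CP v.
have Cbij v : {ae mu, forall x, bijective (C v ^~ x)} by have [] := CP v.
have [c cC cE] := cocycle_extension Eirr pG pH aA Cc Cinv.
have ma g A : measurable A -> measurable (a g @^-1` A).
  by move=> mA; have := (aP g).1 measurableT A mA; rewrite setTI.
exists d, X, mu, a, c; split=> //; split=> //; split.
  elim/(pres_ind pH) => [g|v k h IH g].
    have [->|g1] := pselect (g = 1%g).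
      rewrite (_ : _ @^-1` _ = setT)//; apply/seteqP; split=> // x _ /=.
      exact: cC.1.
    rewrite (_ : _ @^-1` _ = set0)//; apply/seteqP; split=> // x /=.
    by rewrite cC.1 => /esym.
  (* The cocycle equation splits the level set according to the values [p.1] of [c h] and [p.2] of
     [C v k] at the moved point, among countably many pairs. *)
  rewrite (_ : _ @^-1` _ = \bigcup_(p in [set: G * Gv v])
      (if pselect ((iG v p.2 * p.1)%g = g) then
         (c h @^-1` [set p.1]) `&` (a p.1 @^-1` (C v k @^-1` [set p.2]))
       else set0)).
    apply: countable_bigcupT_measurable => [|p].
      by rewrite -setXTT; exact: countableX.
    by case: pselect => //= _; apply: measurableI => //; exact: ma.
  apply/seteqP; split=> [x /= <-|x [[l m] _] /=].
    exists (c h x, C v k (a (c h x) x)) => //=.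
    by rewrite cC.2 cE; case: pselect.
  by case: pselect => //= <- [cl Cm]; rewrite cC.2 cE cl Cm.
have [code [decode codeK]] := countable_code 1%g cG.
have : mu.-negligible (\bigcup_n \big[setU/set0]_(v <- enum V)
    (a (decode n) @^-1` [set x | ~ bijective (C v ^~ x)])).
  apply: negligible_bigcup => n; elim/big_ind: _ => [|A B nA nB|v _].
  - exact: negligible_set0.
  - exact: negligibleU.
  - exact: negligible_preimage (aP _) (Cbij v).
apply: negligibleS => x /= nx; apply: contrapT => nU; apply: nx.
have Cx v g : bijective (C v ^~ (a g x)).
  apply: contrapT => nC; apply: nU; exists (code g) => //.
  by rewrite codeK -bigcup_seq; exists v => //=; rewrite mem_enum.
(* Pull-back along [k |-> a k x] to [G] acting on itself by left multiplication; the conclusion at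
   [k = 1] is the one about [x]. *)
pose C' v (h : Hv v) (k : G) := C v h (a k x).
have C'c v : cocycle (fun g k => iG v g * k)%g (C' v).
  by split=> [k|h l k]; rewrite /C' ?(Cc v).1// (Cc v).2 aA.2.
have := @cocycle_extension_bij V E Eirr Gv Hv G H iG iH G (fun g k => g * k)%g
  C' (fun h k => c h (a k x)) pG pH _ C'c _ _ _ _ 1%g.
rewrite aA.1; apply.
- by split=> [k|g l k]; rewrite ?mul1g ?mulgA.
- by move=> v w h g k wv; rewrite /C' aA.2 Cinv.
- by split=> [k|h l k]; rewrite ?cC.1// cC.2 aA.2.
- by move=> v h k; rewrite cE.
- by move=> v k; exact: Cx.
Qed.

(** * Orbit equivalence and measure equivalence from a bijective cocycle *)

Section Conclusions.
Variables (R : realType) (d : measure_display) (X : measurableType d).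
Variables (mu : probability X R) (G H : groupType).
Variables (a : G -> X -> X) (c : H -> X -> G).
Hypotheses (sX : standard_borel R X) (cG : countable [set: G]).
Hypothesis acP : bijective_cocycle mu a c.

Let aA : is_action a. Proof. by case: acP. Qed.
Let aP g : preserves mu (a g). Proof. by case: acP. Qed.
Let aF : essentially_free mu a. Proof. by case: acP. Qed.
Let cC : cocycle a c. Proof. by case: acP. Qed.
Let mc h g : measurable (c h @^-1` [set g]).
Proof. by case: acP => _ _ _ _ []. Qed.
Let cB : {ae mu, forall x, bijective (c ^~ x)}.
Proof. by case: acP => _ _ _ _ []. Qed.

Lemma bijective_cocycle_orbit_equivalence :
  admit_orbit_equivalent_free_actions R G H.
Proof.
pose b h x := a (c h x) x.
have bA : is_action b.
  by split=> [x|h k x]; rewrite /b ?cC.1 ?aA.1// cC.2 aA.2.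
have bP h : preserves mu (b h).
  apply: preserves_piecewise aA aP cG _ (mc h) _.
  by exists (b h^-1%g); [exact: (actionK bA)|exact: (actionVK bA)].
exists d, d, X, X, mu, mu, a, b; split; [by []|split=> //|split|].
- exact: preserves_mp_action.
- exact: preserves_mp_action.
(* If [h] fixes [x], freeness of [a] gives [c h x = 1 = c 1 x], and injectivity of [c ^~ x] gives
   [h = 1]. *)
- apply: negligibleS (negligibleU aF cB) => x /= nx.
  apply: contrapT => nU; apply: nx => h ch.
  have fx g : a g x = x -> g = 1%g.
    by move: g; apply: contrapT => nf; apply: nU; left.
  have bx : bijective (c ^~ x) by apply: contrapT => nb; apply: nU; right.
  by apply: (bij_inj bx); rewrite /= (fx _ ch) cC.1.
- exists id; first exists setT, setT; first split=> //.
  + by rewrite setCT !measure0.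
  + by split=> //= x _; exists x.
  + by move=> A mA _; rewrite image_id.
  + by move=> B mB; rewrite setTI.
- apply: negligibleS cB => x /= nx; apply: contra_not nx => -[c' _ c'K].
  rewrite image_id; apply/seteqP; split=> y [g _ <-].
    by exists (c' g) => //; rewrite /b c'K.
  by exists (c g x).
Qed.


(** An auxiliary action, distinct from that of [G] in the coupling: [H] acts on the coupling by
    piecewise [gact], so its invariance of the measure follows from [preserves_piecewise]. *)
Let gact (g : G) (z : X * discrete_group G) : X * discrete_group G :=
  (a g z.1, (g * z.2)%g).

Lemma bijective_cocycle_measure_equivalence : measure_equivalent R G H.
Proof.
have sfG := discrete_group_sigma_finite R cG.
pose nu : {sigma_finite_measure set (discrete_group G) -> \bar R} :=
  HB.pack (@counting (discrete_group G) R)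
    (Measure_isSigmaFinite.Build _ _ _ (@counting (discrete_group G) R) sfG).
have nuP (f f' : discrete_group G -> discrete_group G) :
    cancel f f' -> cancel f' f -> preserves nu f.
  by move=> fK f'K; split=> // A _; exact: counting_bij fK f'K.
pose mulr g (k : discrete_group G) : discrete_group G := (k * g)%g.
pose mull g (k : discrete_group G) : discrete_group G := (g * k)%g.
pose m : {measure set (X * discrete_group G) -> \bar R} := (mu \x nu)%E.
pose b (p : G * H) (z : X * discrete_group G) : X * discrete_group G :=
  (a (c p.2 z.1) z.1, (c p.2 z.1 * (z.2 * p.1^-1))%g).
have bA : is_action b.
  split=> [[x k]|[g h] [g' h'] [x k]]; rewrite /b /=.
    by rewrite cC.1 aA.1 invg1 mulg1 mul1g.
  by rewrite cC.2 aA.2 invgM !mulgA.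
have bG g : preserves m (b (g, 1%g)).
  rewrite (_ : b _ = fun z => (z.1, (z.2 * g^-1)%g)); last first.
    by apply/funext => -[x k]; rewrite /b /= cC.1 aA.1 mul1g.
  apply: (preserves_prod (preserves_id mu) (nuP (mulr g^-1%g) (mulr g) _ _)).
    by move=> k; rewrite /mulr mulgVK.
  by move=> k; rewrite /mulr mulgK.
have gactA : is_action gact.
  by split=> [[x k]|g l [x k]]; rewrite /gact /= ?aA.1 ?mul1g// aA.2 mulgA.
have gactP g : preserves m (gact g).
  apply: (preserves_prod (aP g) (nuP (mull g) (mull g^-1%g) _ _)).
    by move=> k; rewrite /mull mulKg.
  by move=> k; rewrite /mull mulVKg.
have bH h : preserves m (b (1%g, h)).
  have bE z : b (1%g, h) z = gact (c h z.1) z.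
    by rewrite /b /gact /= invg1 mulg1.
  rewrite (_ : b _ = fun z => gact (c h z.1) z); last by apply/funext.
  apply: (preserves_piecewise gactA gactP cG (k := fun z => c h z.1)).
    move=> g; rewrite -[X in measurable X]setTI.
    exact: (@measurable_fst _ _ X _ measurableT _ (mc h g)).
  exists (b (1%g, h^-1%g)) => z; rewrite -bE.
    have -> : (1%g, h^-1%g) = (1%g, h)^-1%g :> G * H.
      by congr pair; rewrite invg1.
    exact: actionK.
  have -> : (1%g, h^-1%g) = (1%g, h)^-1%g :> G * H by congr pair; rewrite invg1.
  exact: actionVK.
have mD : measurable (setT `*` [set 1%g] : set (X * discrete_group G)).
  exact: measurableX.
have mD1 : m (setT `*` [set 1%g]) = 1%E.
  apply: etrans (product_measure1E mu nu measurableT _) _ => //.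
  rewrite [X in (X * _)%E]probability_setT mul1e /= /counting asboolT//.
  by rewrite fset_set1 finmap.cardfs1.
have sm : sigma_finite [set: X * discrete_group G] (mu \x nu)%E.
  have [F FT Foo] := sfG; exists (fun n => setT `*` F n).
    by rewrite -setX_bigcupr -FT setXTT.
  move=> n; have [mF Fn] := Foo n; split; first exact: measurableX.
  by rewrite product_measure1E// [X in (X * _)%E]probability_setT mul1e.
have cBZ : m.-negligible (fst @^-1` ~` [set x | bijective (c ^~ x)]).
  exact: (negligible_fst nu cB).
exists _, (X * discrete_group G)%type, m, b; split.
- exact: standard_borel_prod sX (standard_borel_discrete R cG).
- split; first exact: sm.
  move=> m0; have : (m (setT `*` [set 1%g]) <= m setT)%E.
    by apply: le_measure; rewrite ?inE.
  by rewrite mD1 m0 lee_fin ler10.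
- apply: preserves_mp_action => // -[g h].
  rewrite (_ : b _ = b (g, 1%g) \o b (1%g, h)); first exact: preserves_comp.
  apply/funext => z; rewrite /= -bA.2; congr (b _ z).
  by congr pair; rewrite ?mulg1 ?mul1g.
- split.
    apply: negligibleS (negligible_set0 m) => -[x k] /= nx; apply: nx => g [_].
    rewrite cC.1 mul1g -[RHS]mulg1 => /mulgI /eqP.
    by rewrite invg_eq1 => /eqP.
  exists (setT `*` [set 1%g]); last by rewrite mD1 ltry.
  split=> //; apply: negligibleS (negligible_set0 m) => -[x k] /= nx; apply: nx.
  exists (x, 1%g); split=> [|[y l] [[g _ []] /=]].
    split=> //; exists k => //; rewrite /b /= cC.1 aA.1 mul1g.
    by congr pair; rewrite mulgV.
  by rewrite cC.1 aA.1 mul1g => -> _ [_ ->].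
- split.
    apply: negligibleS cBZ => -[x k] /= nx bx; apply: nx => h [_].
    rewrite invg1 mulg1 -[RHS]mul1g => /mulIg; rewrite -(cC.1 x).
    exact: (bij_inj bx).
  exists (setT `*` [set 1%g]); last by rewrite mD1 ltry.
  split=> //; apply: negligibleS cBZ => -[x k] /= nx bx; apply: nx.
  (* The orbit of [(x, k)] meets the slice exactly when [c h x = k^-1]: surjectivity of [c ^~ x]
     supplies [h], and this value determines the point. *)
  have [c' c'K cK'] := bx; exists (a k^-1%g x, 1%g); split=> [|[y l]].
    split=> //; exists (c' k^-1%g) => //; rewrite /b /= cK' invg1 mulg1.
    by rewrite mulVg.
  move=> [[h _ []] /= <- <-] [_]; rewrite invg1 mulg1 => chk.
  have -> : k^-1%g = c h x by apply: (mulIg k); rewrite mulVg.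
  by rewrite chk.
Qed.


End Conclusions.

Theorem proposition4 (R : realType) (V : finType) (E : rel V)
    (hE : simple_graph E) (Gv Hv : V -> groupType) (G H : groupType)
    (hG : splits_as_graph_product E Gv G) (hH : splits_as_graph_product E Hv H)
    (cGv : forall v, countable [set: Gv v]) (cHv : forall v, countable [set: Hv v])
    (hGH : forall v, admit_orbit_equivalent_free_actions R (Gv v) (Hv v)) :
  admit_orbit_equivalent_free_actions R G H /\ measure_equivalent R G H.
Proof.
have [iG pG] := splits_presentation hG; have [iH pH] := splits_presentation hH.
have cG := presentation_countable pG cGv.
have [d [X [mu [a [c [sX ac]]]]]] :=
  graph_product_bijective_cocycle hE.2 pG pH cGv hGH.
split; first exact: (bijective_cocycle_orbit_equivalence sX cG ac).
exact: (bijective_cocycle_measure_equivalence sX cG ac).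
Qed.
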